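(* Each of the following quaternary sums is universal over $\mathbb{Z}$: $6p_4+p_8+p_8+2p_8$, $3p_4+p_8+2p_8+2p_8$, $6p_4+p_8+p_8+3p_8$, $3p_4+p_8+2p_8+3p_8$, $p_4+6p_4+p_8+p_8$, $p_4+3p_4+p_8+2p_8$, $p_4+p_8+p_8+2p_8$, $p_3+p_4+p_5+2p_5$, $p_3+3p_3+p_4+2p_5$, $p_3+6p_3+p_4+p_5$, $p_3+2p_3+3p_4+p_5$, $p_3+2p_3+p_5+p_8$, $p_3+2p_3+3p_3+p_8$.
   Context: For an integer $m\ge 3$ and $x\in\mathbb{Z}$, the generalized $m$-gonal number is $p_m(x)=\frac{(m-2)x^2-(m-4)x}{2}$; thus $p_3(x)=x(x+1)/2$, $p_4(x)=x^2$, $p_5(x)=x(3x-1)/2$, $p_8(x)=x(3x-2)$. For positive integers $a,b,c,d$ and $r,s,t,u\ge 3$, the notation $ap_r+bp_s+cp_t+dp_u$ denotes the function $(h,l,m,n)\mapsto ap_r(h)+bp_s(l)+cp_t(m)+dp_u(n)$ on $\mathbb{Z}^4$ (four independent integer variables). Such a sum is called universal over $\mathbb{Z}$ if its set of values $\{ap_r(h)+bp_s(l)+cp_t(m)+dp_u(n): h,l,m,n\in\mathbb{Z}\}$ equals $\mathbb{N}_0=\{0,1,2,\dots\}$. *)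

(* Defs.v *)
From Stdlib Require Import ZArith.
Open Scope Z_scope.

(* generalized m-gonal number p_m(x) = ((m-2)x^2 - (m-4)x)/2, x in Z
   (the numerator is always even, so Z.div is exact) *)
Definition p (m x : Z) : Z := ((m - 2) * x * x - (m - 4) * x) / 2.

Definition universal4 (a r b s c t d u : Z) : Prop :=
  forall N : Z,
    0 <= N <->
    exists h l m n : Z, a * p r h + b * p s l + c * p t m + d * p u n = N.

(* Main.v *)
(** Multiplying by 3 or 24 and completing squares turns each sum into a diagonal quaternary
    form whose variables must avoid multiples of 2 or 3.  Fixing one variable leaves a number
    of the shape 4k+1, 4k+2 or 8k+3, which is a sum of three squares; the identities
    (x+y)^2 + (x-y)^2 = 2(x^2+y^2) and 3(c^2+2d^2) = (c+2d)^2 + 2(c-d)^2 reshape these squares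
    and restore coprimality to 3.

    The three-square theorem is proved without Dirichlet's theorem on primes.  Let chi be the
    quadratic character modulo k = 8n with chi(q) = (-n/q), and r(s) the sum of chi over the
    divisors of s; then r >= 0, and r(s) <> 0 forces s = s0 j^2 with -n a square modulo s0.
    For a class c with chi(c) = 1 the sums of r(s)/sqrt(s) over s = c and over s = 1 modulo k,
    s <= K^2, differ by a bounded amount (hyperbola method), while the second one diverges
    because of the squares s.  Choosing c = -1 modulo n (or 2c = -1 when n = 3 modulo 8) yields
    s such that -n is a square modulo s and -s is a square modulo n.  Such an s gives a
    positive ternary form of determinant 1 representing n, and by Hermite reduction that form
    is a sum of three squares of linear forms. *)
Require Import Defs.
From Stdlib Require Import ZArith Lia Znumtheory.
From mathcomp Require Import all_boot all_order all_algebra.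
From mathcomp Require Import zify ring lra.
From mathcomp Require Import realalg.
Import Order.TTheory GRing.Theory Num.Theory.
Open Scope Z_scope.

(** * Ternary forms of determinant 1 *)

(** The classical argument takes for s a prime in a residue class, but uses only that -n is a square
    modulo s; any s with r(s) <> 0 offers this through its factor s0. The factor j^2 is harmless: if
    s0 j^2 = -1 modulo n and u = s0 j, then s0 + u^2 = s0 (1 + s0 j^2) is divisible by n. The
    exponent 1/2 is forced: the squares give a divergent series only for exponents up to 1/2, while
    the hyperbola tails, of order K^(1 - 2 sigma) for exponent sigma, stay bounded only from 1/2 on.
    Comparing the class of c with that of 1 replaces any statement about L(1, chi): the difference
    of their indicators at d m has sum zero over a period of m, for every d. For the polygonal sums
    the obstacle is coprimality to 3. A positive value of a^2 + 2 b^2 divisible by 3 is always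
    attained with a and b prime to 3; the side conditions that a number is no square, or that y^2 +
    2 z^2 > 0, only keep such a value from being 0. *)

Definition sum3sq (n : Z) : Prop := exists x y z, n = x * x + y * y + z * z.

(** The form a X^2 + b Y^2 + c Z^2 + 2 d Y Z + 2 e X Z + 2 g X Y is a sum of squares of three
    integral linear forms; [x1], [y1], [z1] are the coefficients of the first one. *)
Definition sum_sq_gram (a b c d e g : Z) : Prop :=
  exists x1 x2 x3 y1 y2 y3 z1 z2 z3 : Z,
    a = x1 * x1 + x2 * x2 + x3 * x3 /\
    b = y1 * y1 + y2 * y2 + y3 * y3 /\
    c = z1 * z1 + z2 * z2 + z3 * z3 /\
    d = y1 * z1 + y2 * z2 + y3 * z3 /\
    e = x1 * z1 + x2 * z2 + x3 * z3 /\
    g = x1 * y1 + x2 * y2 + x3 * y3.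

Lemma sum_sq_gram_shear23 (k a b c d e g : Z) :
  sum_sq_gram a b (c + 2 * k * d + k * k * b) (d + k * b) (e + k * g) g ->
  sum_sq_gram a b c d e g.
Proof.
intros (x1 & x2 & x3 & y1 & y2 & y3 & z1 & z2 & z3 & Ha & Hb & Hc & Hd & He & Hg).
exists x1, x2, x3, y1, y2, y3, (z1 - k * y1), (z2 - k * y2), (z3 - k * y3).
assert (Hd' : d = y1 * z1 + y2 * z2 + y3 * z3 - k * b) by lia.
repeat split; try assumption.
- replace c with (z1 * z1 + z2 * z2 + z3 * z3 - 2 * k * d - k * k * b) by lia.
  rewrite Hd' Hb; ring.
- rewrite Hd' Hb; ring.
- replace e with (x1 * z1 + x2 * z2 + x3 * z3 - k * g) by lia. rewrite Hg; ring.
Qed.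

Lemma sum_sq_gram_shear12 (k a b c d e g : Z) :
  sum_sq_gram a (b + 2 * k * g + k * k * a) c (d + k * e) e (g + k * a) ->
  sum_sq_gram a b c d e g.
Proof.
intros (x1 & x2 & x3 & y1 & y2 & y3 & z1 & z2 & z3 & Ha & Hb & Hc & Hd & He & Hg).
exists x1, x2, x3, (y1 - k * x1), (y2 - k * x2), (y3 - k * x3), z1, z2, z3.
assert (Hg' : g = x1 * y1 + x2 * y2 + x3 * y3 - k * a) by lia.
repeat split; try assumption.
- replace b with (y1 * y1 + y2 * y2 + y3 * y3 - 2 * k * g - k * k * a) by lia.
  rewrite Hg' Ha; ring.
- replace d with (y1 * z1 + y2 * z2 + y3 * z3 - k * e) by lia. rewrite He; ring.
- rewrite Hg' Ha; ring.
Qed.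

Lemma sum_sq_gram_swap23 (a b c d e g : Z) :
  sum_sq_gram a c b d g e -> sum_sq_gram a b c d e g.
Proof.
intros (x1 & x2 & x3 & y1 & y2 & y3 & z1 & z2 & z3 & Ha & Hb & Hc & Hd & He & Hg).
exists x1, x2, x3, z1, z2, z3, y1, y2, y3; repeat split; try assumption.
rewrite Hd; ring.
Qed.

Lemma sum_sq_gram_swap12 (a b c d e g : Z) :
  sum_sq_gram b a c e d g -> sum_sq_gram a b c d e g.
Proof.
intros (x1 & x2 & x3 & y1 & y2 & y3 & z1 & z2 & z3 & Ha & Hb & Hc & Hd & He & Hg).
exists y1, y2, y3, x1, x2, x3, z1, z2, z3; repeat split; try assumption.
rewrite Hg; ring.
Qed.

Lemma centered_residue (a g : Z) : 0 < a -> exists k, 2 * Z.abs (g + k * a) <= a.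
Proof.
intros Ha. exists (- ((2 * g + a) / (2 * a))).
pose proof (Z.div_mod (2 * g + a) (2 * a) ltac:(lia)) as H1.
pose proof (Z.mod_pos_bound (2 * g + a) (2 * a) ltac:(lia)) as H2.
set (q := (2 * g + a) / (2 * a)) in *. set (r := (2 * g + a) mod (2 * a)) in *.
nia.
Qed.

Lemma four_sqr_le (x y : Z) : 2 * Z.abs x <= y -> 4 * (x * x) <= y * y.
Proof.
intros H. rewrite <- (Z.abs_square x).
replace (4 * (Z.abs x * Z.abs x)) with ((2 * Z.abs x) * (2 * Z.abs x)) by ring.
apply Z.mul_le_mono_nonneg; lia.
Qed.

(* Hermite reduction.  With al = a b - g^2, the form a F - (a x + g y + e z)^2 is binary in
   (y, z), has leading coefficient al and determinant a.  Reducing it gives 3 al^2 <= 4 a, and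
   then reducing g modulo a makes b < a unless a = 1: outer induction on a, inner on al. *)
Lemma unimodular_ternary_sum_sq (a b c d e g : Z) :
  0 < a -> 0 < a * b - g * g ->
  a * b * c + 2 * d * e * g - a * d * d - b * e * e - c * g * g = 1 ->
  sum_sq_gram a b c d e g.
Proof.
intros Ha; assert (Ha' : 0 <= a) by lia; revert b c d e g Ha; revert a Ha'.
apply (Z_lt_induction (fun a => forall b c d e g, 0 < a -> 0 < a * b - g * g ->
  a * b * c + 2 * d * e * g - a * d * d - b * e * e - c * g * g = 1 ->
  sum_sq_gram a b c d e g)).
intros a IHa b c d e g Ha Hal Hdet.
remember (a * b - g * g) as al eqn:Eal.
assert (Hal' : 0 <= al) by lia.
revert b c d e g Hal Hdet Eal; revert al Hal'.
apply (Z_lt_induction (fun al => forall b c d e g, 0 < al ->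
  a * b * c + 2 * d * e * g - a * d * d - b * e * e - c * g * g = 1 ->
  al = a * b - g * g -> sum_sq_gram a b c d e g)).
intros al IHal b c d e g Hal Hdet Eal.
destruct (centered_residue al (a * d - e * g) Hal) as [k Hk].
apply (sum_sq_gram_shear23 k).
set (c' := c + 2 * k * d + k * k * b). set (d' := d + k * b). set (e' := e + k * g).
assert (Hdet' : a * b * c' + 2 * d' * e' * g - a * d' * d' - b * e' * e' - c' * g * g = 1)
  by (rewrite <- Hdet; unfold c', d', e'; ring).
assert (Hbe : 2 * Z.abs (a * d' - e' * g) <= al).
{ replace (a * d' - e' * g) with (a * d - e * g + k * al); [exact Hk|].
  rewrite Eal; unfold d', e'; ring. }
clearbody c' d' e'; clear Hk Hdet k c d e.
remember (a * c' - e' * e') as ga eqn:Ega.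
remember (a * d' - e' * g) as be eqn:Ebe.
assert (Hbb := four_sqr_le _ _ Hbe).
(* The binary form has determinant [a] times that of the ternary form. *)
assert (Hphi : al * ga - be * be = a).
{ transitivity (a * (a * b * c' + 2 * d' * e' * g - a * d' * d' - b * e' * e' - c' * g * g)).
  - rewrite Ega Ebe Eal; ring.
  - rewrite Hdet'; ring. }
destruct (Z_lt_ge_dec ga al) as [Hlt|Hge].
- apply sum_sq_gram_swap23.
  assert (Hga : 0 < ga).
  { apply (Zmult_lt_0_reg_r al); [lia|]. pose proof (Z.square_nonneg be); lia. }
  apply (IHal ga); [lia|lia| |exact Ega].
  rewrite <- Hdet'; ring.
(* Here al^2 <= al ga = a + be^2 <= a + al^2 / 4. *)
- assert (Hred : 3 * (al * al) <= 4 * a).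
  { assert (al * al <= al * ga) by (apply Z.mul_le_mono_nonneg_l; lia). lia. }
  destruct (centered_residue a g Ha) as [j Hj].
  apply (sum_sq_gram_shear12 j).
  set (b2 := b + 2 * j * g + j * j * a). set (d2 := d' + j * e'). set (g2 := g + j * a) in *.
  assert (Hdet2 : a * b2 * c' + 2 * d2 * e' * g2 - a * d2 * d2 - b2 * e' * e' - c' * g2 * g2 = 1)
    by (rewrite <- Hdet'; unfold b2, d2, g2; ring).
  assert (Eal2 : a * b2 - g2 * g2 = al) by (rewrite Eal; unfold b2, g2; ring).
  assert (Ebe2 : a * d2 - e' * g2 = be) by (rewrite Ebe; unfold d2, g2; ring).
  assert (Hgg := four_sqr_le _ _ Hj).
  clearbody b2 d2 g2; clear Hdet' Eal Ebe j b d' g IHal.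
  destruct (Z_le_gt_dec a 1) as [Ha1|Ha1].
  + assert (a = 1) by lia; subst a.
    assert (al = 1) by nia. assert (be = 0) by lia. subst al be.
    assert (g2 = 0) by lia. subst g2.
    exists 1, 0, 0, 0, 1, 0, e', 0, 1.
    repeat split; lia.
  + apply sum_sq_gram_swap12.
    assert (Hb2 : b2 < a).
    (* Otherwise 2 al >= 3 a, so 27 a^2 <= 12 al^2 <= 16 a, false for a >= 2. Then a b2 = al + g2^2
       < 3 a^2 / 4 + a^2 / 4. *)
    { assert (H4 : 4 * al < 3 * (a * a)).
      { destruct (Z_lt_ge_dec (4 * al) (3 * (a * a))) as [|C]; [assumption|exfalso].
        assert (H5 : 2 * a <= a * a) by (apply Z.mul_le_mono_nonneg_r; lia).
        assert (H7 : (3 * a) * (3 * a) <= (2 * al) * (2 * al)) by (apply Z.mul_le_mono_nonneg; lia).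
        lia. }
      apply (Zmult_lt_reg_r _ _ a); lia. }
    assert (Hb0 : 0 < b2).
    { apply (Zmult_lt_0_reg_r a); [lia|]. pose proof (Z.square_nonneg g2); lia. }
    apply IHa; [lia|lia|lia|].
    rewrite <- Hdet2; ring.
Qed.

(* With s r = t^2 + n and v = - t / u modulo n, the form
   (s x^2 + 2 t x y + r y^2 + (n z + u x + v y)^2) / n is integral of determinant 1. *)
Lemma three_squares_of_residues (n s t u : Z) : 0 < n -> 0 < s ->
  rel_prime s n -> (s | t * t + n) -> (n | s + u * u) ->
  sum3sq n.
Proof.
intros Hn Hs Hsn [r Hr] [A HA].
(* As s = -u^2 modulo n, a common factor of u and n would divide s. *)
assert (Hun : rel_prime u n).
{ apply rel_prime_sym. destruct (rel_prime_bezout _ _ Hsn) as [p q Hpq].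
  apply bezout_rel_prime. apply Bezout_intro with (u := q + p * A) (v := - p * u).
  replace (s) with (A * n - u * u) in Hpq by lia. rewrite <- Hpq; ring. }
destruct (rel_prime_bezout _ _ Hun) as [p q Hpq].
set (v := - t * p).
assert (HB : (n | t + u * v)).
{ exists (t * q). unfold v. replace (t + u * (- t * p)) with (t * (1 - p * u)) by ring.
  rewrite <- Hpq; ring. }
assert (HC : (n | r + v * v)).
{ apply Gauss with s; [|apply rel_prime_sym; exact Hsn].
  destruct HB as [B HB].
  exists (1 + v * v * A + B * (t - u * v)).
  replace (s * (r + v * v)) with (t * t + n + s * (v * v)) by (rewrite Hr; ring).
  replace s with (A * n - u * u) by lia.
  replace (t * t) with ((B * n - u * v) * (B * n - u * v)) by (rewrite <- HB; ring).
  replace t with (B * n - u * v) by lia. ring. }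
destruct HB as [B HB], HC as [C HC].
assert (G : sum_sq_gram n A C B v u).
{ apply unimodular_ternary_sum_sq; [lia|nia|].
  (* Multiplied by n, the determinant becomes r s - t^2 = n. *)
  apply (Z.mul_reg_l _ _ n); [lia|].
  replace (n * (n * A * C + 2 * B * v * u - n * B * B - A * v * v - C * u * u))
    with ((A * n) * (C * n) + 2 * (B * n) * (u * v) - (B * n) * (B * n)
          - (A * n) * (v * v) - (C * n) * (u * u)) by ring.
  rewrite <- HA, <- HB, <- HC.
  replace ((s + u * u) * (r + v * v) + 2 * (t + u * v) * (u * v) - (t + u * v) * (t + u * v)
    - (s + u * u) * (v * v) - (r + v * v) * (u * u)) with (r * s - t * t) by ring.
  lia. }
destruct G as (x1 & x2 & x3 & _ & _ & _ & _ & _ & _ & H & _).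
exists x1, x2, x3; exact H.
Qed.

Set Implicit Arguments.
Unset Strict Implicit.
Unset Printing Implicit Defensive.
Local Open Scope nat_scope.

(** * Gauss's lemma and quadratic reciprocity *)

(* Signs are encoded as booleans, [true] standing for -1. *)
Definition gauss_sign (p a : nat) : bool :=
  \big[addb/false]_(1 <= i < (p./2).+1) (p./2 < (a * i) %% p).

Lemma Fp_nat_eq (p a b : nat) : prime p ->
  (a%:R == b%:R :> 'F_p)%R = (a == b %[mod p]).
Proof.
move=> pp; rewrite -(inj_eq val_inj) /= !val_Fp_nat //.
Qed.


(** For r < p, the absolute value of the number nearest to 0 in the class of r. *)
Definition fold_mod (p r : nat) : nat := if p./2 < r then p - r else r.

Lemma fold_mod_sign (p r : nat) : prime p -> r < p ->
  (r%:R = (-1) ^+ (p./2 < r)%N * (fold_mod p r)%:R :> 'F_p)%R.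
Proof.
move=> pp rp; rewrite /fold_mod; case: (ltnP p./2 r) => _ /=; last by rewrite mul1r.
rewrite natrB; last exact: ltnW.
by rewrite (pchar_Fp_0 pp) expr1 sub0r mulrNN mul1r.
Qed.

(** From a i = a j or a i = - a j modulo p follows i = j, since 0 < i + j < p excludes the minus
    sign; an injection of 1, ..., (p - 1) / 2 into itself is a permutation. *)
Lemma fold_mod_perm (p a : nat) : prime p -> odd p -> ~~ (p %| a) ->
  perm_eq [seq fold_mod p ((a * i) %% p) | i <- index_iota 1 p./2.+1]
          (index_iota 1 p./2.+1).
Proof.
move=> pp po pa.
set h := p./2.
have p2h : p = h.*2.+1 by rewrite -[LHS]odd_double_half po.
pose r (i : nat) := (a * i) %% p.
pose rho (i : nat) := fold_mod p (r i).
have r_gt0 i : 0 < i <= h -> 0 < r i.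
  move=> /andP[i0 ih]; rewrite lt0n; apply/negP => /eqP ri0.
  have : p %| a * i by apply/eqP.
  rewrite Euclid_dvdM // (negbTE pa) /= => /dvdn_leq; lia.
have r_lt i : r i < p by rewrite ltn_mod prime_gt0.
have rho_rng i : 0 < i <= h -> 0 < rho i <= h.
  move=> ih; have := r_gt0 _ ih; have := r_lt i.
  rewrite /rho /fold_mod -/h; case: (ltnP h (r i)); lia.
have rhoE i : ((a * i)%:R = (-1) ^+ (h < r i)%N * (rho i)%:R :> 'F_p)%R.
  rewrite -fold_mod_sign //; apply/eqP; rewrite Fp_nat_eq // /r modn_mod //.
have rho_inj i j : 0 < i <= h -> 0 < j <= h -> rho i = rho j -> i = j.
  move=> ih jh e.
  have : (((a * i)%:R == (a * j)%:R :> 'F_p) || ((a * i)%:R == - (a * j)%:R :> 'F_p))%R.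
    rewrite !rhoE e; case: (h < r i); case: (h < r j);
      by rewrite /= ?expr0 ?expr1 ?mul1r ?mulN1r ?opprK eqxx ?orbT.
  case/orP.
    rewrite Fp_nat_eq //.
    wlog ij : i j ih jh e / i <= j.
      move=> W; case: (leqP i j) => [/W|/ltnW/W]; first exact.
      by move=> W' ; rewrite eq_sym => /W' ->.
    rewrite eq_sym eqn_mod_dvd ?leq_mul2l ?ij ?orbT //.
    rewrite -mulnBr Euclid_dvdM // (negbTE pa) /=.
    case: (posnP (j - i)) => [|ji /dvdn_leq]; lia.
  rewrite -addr_eq0 -natrD -[X in (_ == X)%R]/(0%:R)%R Fp_nat_eq //.
  rewrite -mulnDr mod0n => /eqP/eqP; rewrite -/(dvdn _ _) Euclid_dvdM // (negbTE pa) /=.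
  move/dvdn_leq; lia.
have U : uniq [seq rho i | i <- index_iota 1 h.+1].
  rewrite map_inj_in_uniq ?iota_uniq // => i j.
  by rewrite !mem_index_iota !ltnS; apply: rho_inj.
apply: uniq_perm => //; first exact: iota_uniq.
apply: (uniq_min_size U _ _).2; last by rewrite size_map.
move=> x /mapP[i]; rewrite mem_index_iota ltnS => ih ->.
by rewrite mem_index_iota ltnS; apply: rho_rng.
Qed.

Lemma gauss_lemma (p a : nat) : prime p -> odd p -> ~~ (p %| a) ->
  (a%:R ^+ p./2 = (-1) ^+ gauss_sign p a :> 'F_p)%R.
Proof.
move=> pp po pa.
have prodE : (\prod_(1 <= i < p./2.+1) (fold_mod p ((a * i) %% p))%:R
    = \prod_(1 <= i < p./2.+1) i%:R :> 'F_p)%R.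
  rewrite -(big_map (fun i => fold_mod p ((a * i) %% p)) predT (fun i => (i%:R)%R)).
  exact: perm_big (fold_mod_perm pp po pa).
have fact_neq0 : (\prod_(1 <= i < p./2.+1) i%:R != 0 :> 'F_p)%R.
  rewrite prodf_seq_neq0; apply/allP => i; rewrite mem_index_iota ltnS => ih /=.
  rewrite -[X in (_ != X)%R]/(0%:R)%R Fp_nat_eq // mod0n.
  by apply/negP => /dvdn_leq; lia.
apply: (mulIf fact_neq0).
transitivity (\prod_(1 <= i < p./2.+1) (a * i)%:R : 'F_p)%R.
  under [RHS]eq_bigr do rewrite natrM.
  by rewrite big_split /= prodr_const_nat subn1.
have modE i : ((a * i)%:R = ((a * i) %% p)%:R :> 'F_p)%R.
  by apply/eqP; rewrite Fp_nat_eq // modn_mod.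
under eq_bigr => i _ do rewrite modE fold_mod_sign ?ltn_mod ?prime_gt0 //.
rewrite big_split /= prodE; congr (_ * _)%R.
rewrite /gauss_sign; elim: (index_iota _ _) => [|i s IH]; first by rewrite !big_nil.
by rewrite !big_cons IH signr_addb.
Qed.

(** Modulo 2, i is the quotient plus the remainder of a i by p. Folding flips the parity of a
    remainder exactly when [gauss_sign] counts it, and the folded remainders permute the i;
    comparing the two sums leaves the quotients. *)
Lemma gauss_sign_odd (p a : nat) : prime p -> odd p -> odd a -> ~~ (p %| a) ->
  gauss_sign p a = odd (\sum_(1 <= i < p./2.+1) (a * i) %/ p).
Proof.
move=> pp po ao pa.
have oddsum (F : nat -> nat) s :
    odd (\sum_(i <- s) F i) = \big[addb/false]_(i <- s) odd (F i).
  exact: (big_morph odd oddD).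
have E1 : \big[addb/false]_(1 <= i < p./2.+1) odd i =
    \big[addb/false]_(1 <= i < p./2.+1) odd ((a * i) %/ p) (+)
    \big[addb/false]_(1 <= i < p./2.+1) odd ((a * i) %% p).
  rewrite -big_split /=; apply: eq_bigr => i _.
  have := congr1 odd (divn_eq (a * i) p).
  by rewrite oddD !oddM ao po andbT.
have E2 : \big[addb/false]_(1 <= i < p./2.+1) odd i =
    gauss_sign p a (+) \big[addb/false]_(1 <= i < p./2.+1) odd ((a * i) %% p).
  rewrite -(perm_big _ (fold_mod_perm pp po pa)) /= big_map -big_split /=.
  apply: eq_bigr => i _; rewrite /fold_mod; case: (ltnP p./2 _) => _ //=.
  by rewrite oddB ?po // ltnW // ltn_mod prime_gt0.
rewrite oddsum; move: E2; rewrite E1 => /addIb ->; done.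
Qed.

Lemma floor_count (p k m : nat) : 0 < p -> m %/ p <= k ->
  m %/ p = \sum_(1 <= j < k.+1) (p * j <= m).
Proof.
move=> p0 mk.
rewrite (big_cat_nat _ _ (n := (m %/ p).+1)) //= [X in _ = X + _](eq_big_nat _ _ (F2 := fun=> 1)).
  rewrite sum_nat_const_nat subn1 /= muln1 big_nat big1 ?addn0 // => j /andP[j1 _].
  by apply/eqP; rewrite eqb0 -ltnNge mulnC -ltn_divLR.
by move=> j /andP[_ j1]; rewrite mulnC -leq_divRL // -ltnS j1.
Qed.

(** Lattice points of a rectangle on either side of its diagonal, on which coprimality allows
    none. *)
Lemma eisenstein_count (p q : nat) : odd p -> odd q -> coprime p q ->
  \sum_(1 <= i < p./2.+1) (q * i) %/ p + \sum_(1 <= j < q./2.+1) (p * j) %/ q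
  = p./2 * q./2.
Proof.
move=> po qo pq.
have pE : p = p./2.*2.+1 by rewrite -[LHS]odd_double_half po.
have qE : q = q./2.*2.+1 by rewrite -[LHS]odd_double_half qo.
set h := p./2 in pE *; set k := q./2 in qE *.
have floorE (h' k' i : nat) : i <= h' -> (k'.*2.+1 * i) %/ h'.*2.+1 <= k'.
  by move=> ih; rewrite -ltnS ltn_divLR //; nia.
rewrite (eq_big_nat _ _ (F2 := fun i => \sum_(1 <= j < k.+1) (p * j <= q * i))); last first.
  by move=> i /andP[_ ih]; apply: floor_count; rewrite ?pE ?qE ?floorE.
rewrite [X in _ + X](eq_big_nat _ _
  (F2 := fun j => \sum_(1 <= i < h.+1) (q * i <= p * j))); last first.
  by move=> i /andP[_ ih]; apply: floor_count; rewrite ?pE ?qE ?floorE.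
rewrite [X in _ + X]exchange_big -big_split /=.
under eq_big_nat => i ih.
  rewrite -big_split /=.
  under eq_big_nat => j jh.
    have -> : (p * j <= q * i) + (q * i <= p * j) = 1.
      case: (ltngtP (p * j) (q * i)) => // e.
      have : p %| i by rewrite -(Gauss_dvdr _ pq) -e dvdn_mulr.
      move/dvdn_leq; lia.
    over.
  rewrite sum_nat_const_nat subn1 muln1; over.
by rewrite sum_nat_const_nat subn1.
Qed.

Lemma gauss_sign_reciprocity (p q : nat) : prime p -> prime q -> odd p -> odd q ->
  p != q -> gauss_sign p q (+) gauss_sign q p = odd p./2 && odd q./2.
Proof.
move=> pp pq po qo npq.
have cpq : coprime p q by rewrite prime_coprime // dvdn_prime2.
have cqp : coprime q p by rewrite coprime_sym.
rewrite !gauss_sign_odd -?prime_coprime // -oddD eisenstein_count //.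
exact: oddM.
Qed.

(** Each 2 i is its own remainder, so the count is that of the i above half of (p - 1) / 2. *)
Lemma gauss_sign2 (p : nat) : odd p -> gauss_sign p 2 = odd (uphalf p./2).
Proof.
move=> po; have pE : p = p./2.*2.+1 by rewrite -[LHS]odd_double_half po.
set h := p./2 in pE *.
have -> : gauss_sign p 2 = odd (\sum_(1 <= i < h.+1) (h < 2 * i)).
  rewrite (big_morph odd oddD (erefl : odd 0 = false)) /gauss_sign.
  rewrite !big_nat; apply: eq_bigr => i ih.
  by rewrite oddb modn_small // pE; lia.
congr odd.
rewrite (big_cat_nat _ _ (n := (h./2).+1)) //=; last by rewrite ltnS; lia.
rewrite big_nat big1 ?add0n => [|j jh]; last by apply/eqP; rewrite eqb0 -leqNgt; lia.
rewrite (eq_big_nat _ _ (F2 := fun=> 1)) => [|j jh]; last by apply/eqP; rewrite eqb1; lia.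
rewrite sum_nat_const_nat muln1; lia.
Qed.

Lemma Fp_signr_inj (p : nat) (b1 b2 : bool) : prime p -> odd p ->
  ((-1) ^+ b1 = (-1) ^+ b2 :> 'F_p)%R -> b1 = b2.
Proof.
move=> pp po.
have N : (1 == -1 :> 'F_p)%R = false.
  rewrite -addr_eq0 -[X in (_ == X)%R]/(0%:R)%R -(natrD _ 1 1) Fp_nat_eq //.
  by case: p pp po => [|[|[|[|p]]]] //; rewrite mod0n modn_small.
case: b1; case: b2 => //= /eqP; rewrite ?expr0 ?expr1 ?N //.
by rewrite eq_sym N.
Qed.

Lemma gauss_signM (p a b : nat) : prime p -> odd p -> ~~ (p %| a) -> ~~ (p %| b) ->
  gauss_sign p (a * b) = gauss_sign p a (+) gauss_sign p b.
Proof.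
move=> pp po pa pb; apply: (Fp_signr_inj pp po).
by rewrite signr_addb -!gauss_lemma // ?Euclid_dvdM ?(negbTE pa) // natrM exprMn.
Qed.

Lemma gauss_sign_mod (p a b : nat) : a = b %[mod p] -> gauss_sign p a = gauss_sign p b.
Proof.
by move=> ab; apply: eq_bigr => i _; rewrite -modnMml ab modnMml.
Qed.

Lemma gauss_sign_opp1 (p a : nat) : prime p -> odd p -> p %| a.+1 ->
  gauss_sign p a = odd p./2.
Proof.
move=> pp po pa; apply: (Fp_signr_inj pp po).
have pna : ~~ (p %| a).
  apply/negP => pa'; have := dvdn_sub pa pa'.
  by rewrite subSnn dvdn1 => /eqP p1; rewrite p1 in pp.
rewrite -gauss_lemma // signr_odd; congr (_ ^+ _)%R.
apply/eqP; rewrite -addr_eq0 -(natrD _ a 1) addn1 -[X in (_ == X)%R]/(0%:R)%R.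
by rewrite Fp_nat_eq // mod0n.
Qed.

(** With h = (p - 1) / 2, the squares of 1, ..., h are h distinct roots of X^h - 1, which has no
    more; so the root [a] is one of them. *)
Lemma euler_square (p a : nat) : prime p -> odd p ->
  (a%:R ^+ p./2 = 1 :> 'F_p)%R -> exists t, t ^ 2 = a %[mod p].
Proof.
move=> pp po a1.
have p2h : p = p./2.*2.+1 by rewrite -[LHS]odd_double_half po.
set h := p./2 in p2h a1.
pose sq (i : nat) : 'F_p := (i%:R ^+ 2)%R.
case: (boolP ((a%:R)%R \in [seq sq i | i <- index_iota 1 h.+1])) => [/mapP[i _ e]|na].
  by exists i; apply/eqP; rewrite -Fp_nat_eq // natrX e.
have h0 : 0 < h by have := prime_gt1 pp; lia.
have root_sq i : 0 < i <= h -> (sq i ^+ h = 1)%R.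
  move=> ih; rewrite -exprM mul2n.
  have pi : ~~ (p %| i) by apply/negP => /dvdn_leq; lia.
  have : (i%:R ^+ h = 1 :> 'F_p \/ i%:R ^+ h = -1 :> 'F_p)%R.
    by rewrite /h gauss_lemma //; case: gauss_sign; [right|left].
  by rewrite -muln2 exprM; case=> ->; rewrite ?sqrrN expr1n.
pose P := ('X^h - 1 : {poly 'F_p})%R.
have sP : size P = h.+1 by rewrite /P size_XnsubC.
have P0 : P != 0%R by rewrite -size_poly_eq0 sP.
pose rs := ((a%:R)%R :: [seq sq i | i <- index_iota 1 h.+1]).
suff [rsP rsU] : all (root P) rs /\ uniq [seq sq i | i <- index_iota 1 h.+1].
  have := max_poly_roots P0 rsP; rewrite /= na rsU sP size_map size_iota subn1 /= ltnn.
  by move/(_ isT).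
split.
  rewrite /= rootE !hornerE a1 subrr eqxx /=.
  apply/allP => x /mapP[i]; rewrite mem_index_iota ltnS => ih ->.
  by rewrite rootE !hornerE root_sq // subrr.
rewrite map_inj_in_uniq ?iota_uniq // => i j.
rewrite !mem_index_iota !ltnS => ih jh /eqP.
rewrite eqf_sqr => /orP[|].
  rewrite Fp_nat_eq // !modn_small; [by move/eqP|lia|lia].
rewrite -addr_eq0 -natrD -[X in (_ == X)%R]/(0%:R)%R Fp_nat_eq // mod0n.
move/dvdn_leq; lia.
Qed.

Lemma euler_square_opp (q n : nat) : prime q -> odd q -> ~~ (q %| n) ->
  ~~ (odd q./2 (+) gauss_sign q n) -> exists t, q %| t ^ 2 + n.
Proof.
move=> pq qo qn X.
have q0 : 0 < q by apply: prime_gt0.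
(* Among natural numbers, n (q - 1) stands for -n. *)
have [t tE] : exists t, t ^ 2 = n * q.-1 %[mod q].
  apply: euler_square => //; rewrite natrM exprMn gauss_lemma //.
  have -> : ((q.-1)%:R = -1 :> 'F_q)%R.
    by apply/eqP; rewrite -addr_eq0 -(natrD _ _ 1) addn1 prednK // (pchar_Fp_0 pq).
  by rewrite -(signr_odd _ q./2) -signr_addb addbC (negbTE X).
exists t; rewrite /dvdn -modnDml tE modnDml -{2}[n]muln1 -mulnDr addn1 prednK //.
by rewrite modnMl.
Qed.

(* For [E l = gauss_sign l a] this is the Jacobi symbol (a/m). *)
Definition prime_sum (E : nat -> bool) (m : nat) : bool :=
  \big[addb/false]_(l < m.+1 | prime l) (odd (logn l m) && E l).

Lemma prime_sum_widen (E : nat -> bool) (m B : nat) : 0 < m -> m < B ->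
  prime_sum E m = \big[addb/false]_(l < B | prime l) (odd (logn l m) && E l).
Proof.
move=> m0 mB; rewrite /prime_sum.
rewrite -!(big_mkord prime (fun l => odd (logn l m) && E l)).
rewrite (big_cat_nat (n := m.+1) _ mB) //=.
rewrite [X in _ = _ (+) X]big1_seq ?addbF // => l /andP[_].
rewrite mem_index_iota => /andP[ml _]; suff -> : logn l m = 0 by [].
apply/eqP; rewrite -leqn0 leqNgt logn_gt0 mem_primes.
by apply/negP => /and3P[_ _ /dvdn_leq]; lia.
Qed.

(** A multiplicative sign is determined by its values at primes. Additivity is asked only on
    divisors of [m] because [gauss_sign] has it only away from its prime, and the parities of halves
    only on odd numbers. *)
Lemma prime_sum_mul (E : nat -> bool) (m : nat) : 0 < m -> E 1 = false ->
  (forall a b, a * b %| m -> E (a * b) = E a (+) E b) -> prime_sum E m = E m.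
Proof.
elim/ltn_ind: m => m IH m0 E1 EM.
case: (leqP m 1) => [m1|m1].
  have -> : m = 1 by lia.
  by rewrite E1 /prime_sum big1 // => i _; rewrite logn1.
have pl := pdiv_prime m1; set l := pdiv m in pl.
have lm : l %| m by apply: pdiv_dvd.
have mE : m = l * (m %/ l) by rewrite mulnC divnK.
set m' := m %/ l in mE.
have m'0 : 0 < m' by lia.
have m'm : m' < m by rewrite mE; have := prime_gt1 pl; nia.
rewrite [in RHS]mE EM -?mE // -(IH m') //; last first.
  by move=> a b ab; apply: EM; apply: dvdn_trans ab _; rewrite mE dvdn_mull.
rewrite (prime_sum_widen E m0 (ltnSn m)) (prime_sum_widen E m'0 (ltnW (m'm : m'.+1 < m.+1))).
have lognE i : prime i -> logn i m = (i == l) + logn i m'.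
  by move=> ip; rewrite {1}mE lognM ?(prime_gt0 pl) // logn_prime // eq_sym.
have lB : l < m.+1 by rewrite ltnS dvdn_leq.
rewrite (bigD1 (Ordinal lB)) // [in RHS](bigD1 (Ordinal lB)) //=.
rewrite addbA; congr (_ (+) _); last first.
  apply: eq_bigr => i /andP[ip il].
  by rewrite lognE //; move: il; rewrite -val_eqE /= => /negbTE ->.
by rewrite lognE // eqxx add1n /=; case: (odd _); case: (E l).
Qed.

Lemma eq_prime_sum (E F : nat -> bool) (m : nat) : 0 < m ->
  (forall l, prime l -> l %| m -> E l = F l) -> prime_sum E m = prime_sum F m.
Proof.
move=> m0 EF; apply: eq_bigr => l pl.
case: (boolP (odd _)) => //= ol; apply: EF => //.
have : 0 < logn l m by case: (logn l m) ol.
by rewrite logn_gt0 mem_primes => /and3P[].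
Qed.

Lemma prime_sum_addb (E F : nat -> bool) (m : nat) :
  prime_sum (fun l => E l (+) F l) m = prime_sum E m (+) prime_sum F m.
Proof.
by rewrite -big_split; apply: eq_bigr => l _ /=; case: odd.
Qed.

(** For odd a, [odd a./2] encodes (-1/a). *)
Lemma odd_half_mul (a b : nat) : odd a -> odd b ->
  odd (a * b)./2 = odd a./2 (+) odd b./2.
Proof.
move=> ao bo; have aE := odd_double_half a; have bE := odd_double_half b.
rewrite ao in aE; rewrite bo in bE; set x := a./2 in aE *; set y := b./2 in bE *.
have -> : (a * b)./2 = x + y + (x * y).*2 by rewrite -aE -bE; lia.
by rewrite !oddD odd_double addbF.
Qed.

(** For odd a, [odd (uphalf a./2)] encodes (2/a): it is true for a = 3 or 5 modulo 8. *)
Lemma odd_uphalf_half_mul (a b : nat) : odd a -> odd b ->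
  odd (uphalf (a * b)./2) = odd (uphalf a./2) (+) odd (uphalf b./2).
Proof.
move=> ao bo; have aE := odd_double_half a; have bE := odd_double_half b.
rewrite ao in aE; rewrite bo in bE; set x := a./2 in aE *; set y := b./2 in bE *.
have -> : (a * b)./2 = x + y + (x * y).*2 by rewrite -aE -bE; lia.
have : odd (x * y) = odd x && odd y by rewrite oddM.
move: (x * y) => z; case: (odd x) / (boolP (odd x)) => xo;
  case: (odd y) / (boolP (odd y)) => yo /= zo;
  case: (odd (uphalf x)) / (boolP (odd (uphalf x))) => ux;
  case: (odd (uphalf y)) / (boolP (odd (uphalf y))) => uy /=; lia.
Qed.

(** * The quadratic character attached to -n *)

(* The symbol (-2^e m / a) for odd m and a: the factors (-1/a), (2/a)^e, and (m/a) turned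
   into (a/m) by reciprocity, which makes periodicity in [a] visible. *)
Definition kron (e : bool) (m a : nat) : bool :=
  odd a./2 (+) (e && odd (uphalf a./2)) (+)
  (prime_sum (fun l => gauss_sign l a) m (+) (odd a./2 && odd m./2)).

Lemma kronM (e : bool) (m a b : nat) : odd m -> odd a -> odd b ->
  coprime a m -> coprime b m -> kron e m (a * b) = kron e m a (+) kron e m b.
Proof.
move=> mo ao bo am bm; have m0 : 0 < m by case: m mo {am bm}.
rewrite /kron odd_half_mul // odd_uphalf_half_mul //.
have -> : prime_sum (gauss_sign^~ (a * b)) m =
    prime_sum (gauss_sign^~ a) m (+) prime_sum (gauss_sign^~ b) m.
  rewrite -prime_sum_addb; apply: eq_prime_sum => // l pl lm.
  have nd c : coprime c m -> ~~ (l %| c).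
    move=> cm; rewrite -prime_coprime //; apply: coprime_dvdl lm _.
    by rewrite coprime_sym.
  by rewrite gauss_signM ?nd //; apply: dvdn_odd lm mo.
by case: e (odd _) (odd _) (odd _) (odd _) (odd _) (prime_sum _ _) (prime_sum _ _)
  => [] [] [] [] [] [] [] [].
Qed.

Lemma kron_periodic (e : bool) (m a : nat) : kron e m (a + 8 * m) = kron e m a.
Proof.
rewrite /kron; congr (_ (+) _ (+) (_ (+) _)).
- by rewrite (_ : (a + 8 * m)./2 = a./2 + (m.*2).*2) ?oddD ?odd_double ?addbF //; lia.
- congr (_ && _); rewrite (_ : uphalf _ = uphalf a./2 + m.*2) ?oddD ?odd_double ?addbF //; lia.
- apply: eq_bigr => l _; case: (boolP (odd _)) => //= ol.
  apply: gauss_sign_mod; rewrite -modnDmr -[in LHS](_ : 0 = (8 * m) %% l) ?addn0 //.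
  apply/esym/eqP; apply: dvdn_mull.
  have : 0 < logn l m by case: (logn l m) ol.
  by rewrite logn_gt0 mem_primes => /and3P[].
- by rewrite (_ : (a + 8 * m)./2 = a./2 + (m.*2).*2) ?oddD ?odd_double ?addbF //; lia.
Qed.

(** Reciprocity is applied at each prime divisor l of m; by [prime_sum_mul] the correction signs of
    the pairs q, l combine to that of q, m. Hence [kron e m q] is the Legendre symbol of -2^e m. *)
Lemma kron_prime (e : bool) (m q : nat) : odd m -> prime q -> odd q -> coprime q m ->
  ~~ kron e m q -> exists t, q %| t ^ 2 + 2 ^ e * m.
Proof.
move=> mo pq qo qm X; have m0 : 0 < m by case: m mo {qm X}.
have q2 : ~~ (q %| 2) by apply/negP => /dvdn_leq; have := prime_gt1 pq; lia.
have qnm : ~~ (q %| m) by rewrite -prime_coprime.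
apply: euler_square_opp => //.
  by rewrite Euclid_dvdM // negb_or qnm andbT; case: e {X} => //; rewrite dvdn1; lia.
suff -> : gauss_sign q (2 ^ e * m) = (e && odd (uphalf q./2)) (+)
  (prime_sum (gauss_sign^~ q) m (+) (odd q./2 && odd m./2)).
  by rewrite addbA; exact: X.
have -> : gauss_sign q (2 ^ e * m) = (e && odd (uphalf q./2)) (+) gauss_sign q m.
  case: e {X}; last by rewrite mul1n.
  by rewrite gauss_signM // gauss_sign2.
congr (_ (+) _).
have G1 : gauss_sign q 1 = false.
  have := gauss_signM pq qo (a := 1) (b := 1); rewrite dvdn1 muln1.
  by case: gauss_sign => // -> //; lia.
rewrite -(@prime_sum_mul (gauss_sign q) m) //; last first.
  move=> a b ab; apply: gauss_signM => //; apply: contra qnm => qd;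
    apply: dvdn_trans qd (dvdn_trans _ ab); [exact: dvdn_mulr|exact: dvdn_mull].
have <- : prime_sum (fun l => odd q./2 && odd l./2) m = odd q./2 && odd m./2.
  apply: prime_sum_mul => //=; first by rewrite andbF.
  move=> a b /dvdn_odd/(_ mo); rewrite oddM => /andP[ao bo].
  by rewrite odd_half_mul //; case: (odd q./2).
rewrite -prime_sum_addb; apply: eq_prime_sum => // l pl lm.
have lo := dvdn_odd lm mo.
rewrite -gauss_sign_reciprocity //; first by rewrite addbC -addbA addbb addbF.
by apply: contraNneq qnm => ->.
Qed.

Lemma prime_sum_opp1 (m a : nat) : odd m -> m %| a.+1 ->
  prime_sum (gauss_sign^~ a) m = odd m./2.
Proof.
move=> mo ma; have m0 : 0 < m by case: m mo {ma}.
rewrite -[RHS](@prime_sum_mul (fun x => odd x./2) m) //.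
  apply: eq_prime_sum => // l pl lm; apply: gauss_sign_opp1 => //.
    exact: dvdn_odd lm mo.
  exact: dvdn_trans lm ma.
by move=> x y /dvdn_odd/(_ mo); rewrite oddM => /andP[]; apply: odd_half_mul.
Qed.

(** As a = -1/2 modulo m, its symbol is that of -2, which is 1 for m = 3 modulo 8. *)
Lemma prime_sum_opp_half (m a : nat) : m %% 8 = 3 -> m %| (2 * a).+1 ->
  prime_sum (gauss_sign^~ a) m = false.
Proof.
move=> m3 ma; have m0 : 0 < m by lia.
have mo : odd m by lia.
transitivity (odd m./2 (+) odd (uphalf m./2)); last by lia.
rewrite -[RHS](@prime_sum_mul (fun x => odd x./2 (+) odd (uphalf x./2)) m) //; last first.
  move=> x y /dvdn_odd/(_ mo); rewrite oddM => /andP[xo yo].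
  by rewrite odd_half_mul // odd_uphalf_half_mul // addbACA.
apply: eq_prime_sum => // l pl lm.
have lo := dvdn_odd lm mo.
have la := dvdn_trans lm ma.
have na c : l %| c -> l %| c.+1 -> False.
  by move=> lc lc1; have := dvdn_sub lc1 lc; rewrite subSnn dvdn1 => /eqP l1; rewrite l1 in pl.
have l2 : ~~ (l %| 2) by apply/negP => /dvdn_leq; have := prime_gt1 pl; lia.
have lna : ~~ (l %| a) by apply/negP => d; apply: na la; apply: dvdn_mull.
rewrite -(gauss_sign_opp1 pl lo la) gauss_signM // gauss_sign2 //.
by rewrite -addbA addbC -addbA addbb addbF.
Qed.

(* For n = 3 modulo 8 the class -1 has character -1, whence the class -1/2 instead. *)
Lemma quadratic_character (n : nat) : (n %% 4 == 1) || (n %% 4 == 2) || (n %% 8 == 3) ->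
  exists (X : nat -> bool) (c : nat),
  [/\ forall a b, coprime a (8 * n) -> coprime b (8 * n) -> X (a * b) = X a (+) X b,
      forall a, X (a + 8 * n) = X a,
      forall q, prime q -> coprime q (8 * n) -> ~~ X q -> exists t, q %| t ^ 2 + n,
      coprime c (8 * n) /\ ~~ X c
    & n %| (if n %% 8 == 3 then (2 * c).+1 else c.+1)].
Proof.
move=> nE.
have [e [m [mo nem]]] : exists (e : bool) m, odd m /\ n = 2 ^ e * m.
  case: (boolP (odd n)) => no; first by exists false, n; rewrite mul1n.
  by exists true, n./2; split; [|rewrite expn1]; lia.
have odd8 a : coprime a (8 * n) -> odd a.
  by rewrite coprimeMr => /andP[]; rewrite (_ : 8 = 2 ^ 3) // coprime_pexpr // coprimen2.
have cm a : coprime a (8 * n) -> coprime a m.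
  by rewrite coprimeMr => /andP[_]; rewrite {1}nem coprimeMr => /andP[].
have c8 a : odd a -> coprime a n -> coprime a (8 * n).
  by move=> ao an; rewrite coprimeMr an andbT (_ : 8 = 2 ^ 3) // coprime_pexpr // coprimen2.
(* The class must be odd too: n./2 is odd for n = 3 modulo 8, and 2 n - 1 is -1 modulo n and odd for
   every n. *)
exists (kron e m), (if n %% 8 == 3 then n./2 else (2 * n).-1); split.
- by move=> a b ca cb; apply: kronM => //; [exact: odd8|exact: odd8|exact: cm|exact: cm].
(* For n = 2 m the period 8 n is twice the period 8 m of [kron]. *)
- move=> a; rewrite [in LHS]nem; case: (e); last by rewrite mul1n kron_periodic.
  rewrite (_ : a + 8 * (2 ^ true * m) = a + 8 * m + 8 * m) ?kron_periodic //.
  by rewrite -[2 ^ true]/2 mul2n -addnn mulnDr addnA.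
- by move=> q pq cq Xq; have := kron_prime mo pq (odd8 _ cq) (cm _ cq) Xq; rewrite -nem.
- case: ifP => n8.
    have E : n = (2 * n./2).+1 by lia.
    have [e0 mE] : e = false /\ m = n.
      by case: (e) nem => nE'; [rewrite expn1 in nE'; lia|rewrite mul1n in nE'].
    split.
      apply: c8; first by lia.
      have := coprimenS (2 * n./2); rewrite coprimeMl => /andP[_].
      by rewrite -E.
    rewrite /kron e0 mE prime_sum_opp_half //=; [|lia|by rewrite -E].
    have -> : odd n./2 by lia.
    by case: (odd _).
  have N0 : 0 < n by lia.
  split.
    apply: c8; first by lia.
    have -> : (2 * n).-1 = n.-1 + n by lia.
    rewrite coprime_sym /coprime gcdnDr -/(coprime _ _) coprime_sym.
    by rewrite -[X in coprime _ X]prednK // coprimenS.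
  rewrite /kron prime_sum_opp1 //; last first.
    by rewrite prednK; [rewrite [X in _ %| _ * X]nem mulnA dvdn_mull|lia].
  have -> : odd (2 * n).-1./2 = ~~ odd n by lia.
  case: (e) nem => nE'; first rewrite expn1 in nE'; last rewrite mul1n in nE'.
    have -> : odd (uphalf (2 * n).-1./2) by lia.
    have -> : odd n = false by lia.
    by case: (odd _).
  have -> : odd n by lia.
  have -> : odd m./2 = false by lia.
  by [].
- case n8: (n %% 8 == 3); first by rewrite (_ : (2 * n./2).+1 = n) //; lia.
  by rewrite prednK ?dvdn_mull //; lia.
Qed.

(** * Numbers with nonzero character sum in a residue class *)

Local Open Scope ring_scope.

(** * Abel summation with periodic coefficients *)

Lemma abel_bound (R : realFieldType) (b h : nat -> R) (C : R) (n : nat) :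
  (forall m, `|\sum_(0 <= i < m) b i| <= C) ->
  (forall i, h i.+1 <= h i) -> (forall i, 0 <= h i) ->
  `|\sum_(0 <= i < n) b i * h i| <= C * h 0%N.
Proof.
move=> bC hdec h0.
pose A m := \sum_(0 <= i < m) b i.
have -> : \sum_(0 <= i < n) b i * h i =
    \sum_(0 <= i < n) A i.+1 * (h i - h i.+1) + A n * h n.
  elim: n => [|n IH]; first by rewrite /A !big_nil mul0r addr0.
  rewrite !big_nat_recr //= IH /A !big_nat_recr //=.
  ring.
have -> : C * h 0%N = \sum_(0 <= i < n) C * (h i - h i.+1) + C * h n.
  rewrite -mulr_sumr -mulrDr; congr (_ * _).
  elim: n => [|n IH]; first by rewrite big_nil add0r.
  by rewrite big_nat_recr //= -addrA subrK.
apply: le_trans (ler_normD _ _) _; apply: lerD; last first.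
  by rewrite normrM (ger0_norm (h0 n)); apply: ler_wpM2r => //; apply: bC.
apply: le_trans (ler_norm_sum _ _ _) _; apply: ler_sum => i _.
have d0 : 0 <= h i - h i.+1 by rewrite subr_ge0.
by rewrite normrM (ger0_norm d0); apply: ler_wpM2r => //; apply: bC.
Qed.

(** Full periods cancel wherever they start, and fewer than [k] terms remain. *)
Lemma periodic_sum_bound (R : realFieldType) (a : nat -> R) (k : nat) (B : R) :
  (0 < k)%N -> (forall i, a (i + k)%N = a i) -> \sum_(0 <= i < k) a i = 0 ->
  (forall i, `|a i| <= B) -> forall u n, `|\sum_(0 <= i < n) a (u + i)%N| <= B *+ k.
Proof.
move=> k0 per z aB u n.
have shift v : \sum_(0 <= i < k) a (v + i)%N = 0.
  elim: v => [//|v IH]; apply: (addrI (a v)).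
  transitivity (\sum_(0 <= i < k.+1) a (v + i)%N).
    by rewrite big_nat_recl // addn0; congr (_ + _); apply: eq_bigr => i _; rewrite addSnnS.
  by rewrite big_nat_recr //= IH add0r per addr0.
have B0 : 0 <= B by apply: le_trans (aB 0%N).
elim/ltn_ind: n u => n IH u; case: (ltnP n k) => nk.
  apply: le_trans (ler_norm_sum _ _ _) _.
  apply: (@le_trans _ _ (\sum_(0 <= i < n) B)); first by apply: ler_sum => i _; apply: aB.
  rewrite big_const_nat iter_addr addr0 subn0.
  by apply: ler_wpMn2l => //; apply: ltnW.
rewrite (big_cat_nat (n := k)) //= shift add0r.
rewrite -{1}[k]add0n big_addn; under eq_bigr do rewrite [(_ + k)%N]addnC addnA.
by apply: IH; lia.
Qed.

Lemma periodic_abel_bound (R : realFieldType) (a g : nat -> R) (k : nat) (B : R) (u v : nat) :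
  (0 < k)%N -> (forall i, a (i + k)%N = a i) -> \sum_(0 <= i < k) a i = 0 ->
  (forall i, `|a i| <= B) ->
  (forall i, (u <= i)%N -> g i.+1 <= g i) -> (forall i, 0 <= g i) ->
  `|\sum_(u <= i < v) a i * g i| <= B *+ k * g u.
Proof.
move=> k0 per z aB gdec g0.
rewrite -{1}[u]add0n big_addn.
have := @abel_bound R (fun i => a (u + i)%N) (fun i => g (u + i)%N) (B *+ k) (v - u).
rewrite addn0; under eq_bigr do rewrite addnC.
apply.
- exact: periodic_sum_bound.
- by move=> i; rewrite addnS; apply: gdec; rewrite leq_addr.
- by [].
Qed.

Lemma harmonic_lower (R : realFieldType) (t : nat) :
  t%:R / 2 <= \sum_(0 <= i < 2 ^ t) (i.+1%:R)^-1 :> R.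
Proof.
elim: t => [|t IH]; first by rewrite mul0r sumr_ge0 // => i _; rewrite invr_ge0.
have t2 : (2 ^ t <= 2 ^ t.+1)%N by rewrite leq_pexp2l.
rewrite (big_cat_nat (n := (2 ^ t)%N)) //= -natr1 mulrDl; apply: lerD => //.
apply: (@le_trans _ _ (\sum_(2 ^ t <= i < 2 ^ t.+1) ((2 ^ t.+1)%:R)^-1)).
  rewrite big_const_nat iter_addr addr0 (_ : 2 ^ t.+1 - 2 ^ t = 2 ^ t)%N; last by rewrite expnS; lia.
  rewrite -[X in _ <= X]mulr_natl expnS natrM invfM [X in _ <= X]mulrCA mulfV ?mulr1 ?mul1r //.
  by rewrite pnatr_eq0 expn_eq0.
rewrite !big_nat; apply: ler_sum => i /andP[_ it].
by rewrite lef_pV2 ?posrE ?ltr0n ?expn_gt0 // ler_nat.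
Qed.

Definition invsqrt (R : rcfType) (n : nat) : R := (Num.sqrt n%:R)^-1.

Lemma invsqrt_ge0 (R : rcfType) n : 0 <= invsqrt R n.
Proof. by rewrite invr_ge0 sqrtr_ge0. Qed.

Lemma invsqrt1 (R : rcfType) : invsqrt R 1 = 1.
Proof. by rewrite /invsqrt sqrtr1 invr1. Qed.

Lemma invsqrtM (R : rcfType) m n : invsqrt R (m * n) = invsqrt R m * invsqrt R n.
Proof. by rewrite /invsqrt natrM sqrtrM ?ler0n // invfM. Qed.

Lemma invsqrt_sq (R : rcfType) n : invsqrt R (n * n) = (n%:R)^-1.
Proof. by rewrite /invsqrt natrM -expr2 sqrtr_sqr ger0_norm. Qed.

Lemma invsqrt_dec (R : rcfType) n : (0 < n)%N -> invsqrt R n.+1 <= invsqrt R n.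
Proof.
move=> n0; rewrite lef_pV2 ?posrE ?sqrtr_gt0 ?ltr0n //.
by apply: ler_wsqrtr; rewrite ler_nat.
Qed.

Lemma invsqrt_sum (R : rcfType) K :
  (\sum_(1 <= d < K.+1) invsqrt R d) * invsqrt R K.+1 <= 2.
Proof.
have S : \sum_(1 <= d < K.+1) invsqrt R d <= 2 * Num.sqrt (K%:R).
  elim: K => [|K IH]; first by rewrite big_nil sqrtr0 mulr0.
  rewrite big_nat_recr //=; apply: le_trans (lerD IH (lexx _)) _.
  rewrite /invsqrt; set a := Num.sqrt K%:R; set b := Num.sqrt K.+1%:R.
  have a0 : 0 <= a by apply: sqrtr_ge0.
  have b0 : 0 < b by rewrite sqrtr_gt0 ltr0n.
  have ab : b ^+ 2 = a ^+ 2 + 1 by rewrite !sqr_sqrtr ?ler0n // natr1.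
  (* Multiplied by b, the inequality 2 a + 1/b <= 2 b is (b - a)^2 >= 0, because b^2 = a^2 + 1. *)
  rewrite -(ler_pM2r b0) mulrDl mulVf ?gt_eqF // -subr_ge0.
  rewrite [leRHS](_ : _ = (b - a) ^+ 2 + (b ^+ 2 - (a ^+ 2 + 1))); last by ring.
  by rewrite ab subrr addr0 sqr_ge0.
apply: le_trans (ler_wpM2r (invsqrt_ge0 R _) S) _.
rewrite -mulrA ler_piMr // ler_pdivrMr ?sqrtr_gt0 ?ltr0n // mul1r.
by apply: ler_wsqrtr; rewrite ler_nat.
Qed.

(** * Hyperbola method for the difference of two classes *)

Lemma sum_multiples (R : nmodType) (f : nat -> R) (d X : nat) : (0 < d)%N ->
  \sum_(1 <= s < X.+1 | (d %| s)%N) f s = \sum_(1 <= m < (X %/ d).+1) f (d * m)%N.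
Proof.
move=> d0.
rewrite -big_filter -(big_map (fun m => d * m)%N predT f); apply: perm_big.
apply: uniq_perm; first by rewrite filter_uniq ?iota_uniq.
  by rewrite map_inj_uniq ?iota_uniq // => x y /eqP; rewrite eqn_pmul2l // => /eqP.
move=> s; rewrite mem_filter mem_index_iota; apply/idP/mapP.
  move=> /andP[/dvdnP[m ->] /andP[m1 mX]]; exists m; last by rewrite mulnC.
  by rewrite mem_index_iota ltnS leq_divRL //; move: m1 mX; case: m => [|m]; rewrite ?mul0n.
move=> [m]; rewrite mem_index_iota ltnS leq_divRL // => /andP[m1 mX] ->.
by rewrite dvdn_mulr //= ltnS mulnC mX muln_gt0 m1 d0.
Qed.

Lemma sum_divisors_swap (R : nmodType) (F : nat -> nat -> R) (P : pred nat) (X : nat) :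
  \sum_(1 <= s < X.+1 | P s) \sum_(d <- divisors s) F d s =
  \sum_(1 <= d < X.+1) \sum_(1 <= m < (X %/ d).+1 | P (d * m)%N) F d (d * m)%N.
Proof.
transitivity (\sum_(1 <= s < X.+1) \sum_(1 <= d < X.+1 | (d %| s)%N) (if P s then F d s else 0)).
  rewrite big_mkcond !big_nat; apply: eq_bigr => s /andP[s0 sX].
  rewrite -(big_filter _ (fun d => d %| s)%N).
  have -> : \sum_(i <- [seq i <- index_iota 1 X.+1 | (i %| s)%N]) (if P s then F i s else 0)
     = \sum_(d <- divisors s) (if P s then F d s else 0).
    apply: perm_big; apply: uniq_perm; rewrite ?filter_uniq ?iota_uniq ?divisors_uniq //.
    move=> d; rewrite mem_filter mem_index_iota -dvdn_divisors //.
    case: (boolP (d %| s)%N) => //= ds; have := dvdn_leq s0 ds; have := dvdn_gt0 s0 ds; lia.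
  by case: (P s) => //; rewrite big1.
rewrite (exchange_big_dep predT) //= !big_nat; apply: eq_bigr => d /andP[d0 _].
by rewrite sum_multiples // [RHS]big_mkcond.
Qed.

Lemma eqn_mod_coprime2l (k c x y : nat) : coprime c k ->
  (c * x == c * y %[mod k]) = (x == y %[mod k])%N.
Proof.
move=> ck.
wlog xy : x y / (x <= y)%N.
  by move=> W; case: (leqP x y) => [|/ltnW] /W //; rewrite eq_sym => ->; rewrite eq_sym.
rewrite eq_sym [RHS]eq_sym !eqn_mod_dvd ?leq_mul2l ?xy ?orbT //.
by rewrite -mulnBr Gauss_dvdr // coprime_sym.
Qed.

Definition class_diff (R : pzRingType) (k c s : nat) : R :=
  (s == c %[mod k])%:R - (s == 1 %[mod k])%N%:R.

(** The substitution of c m for m permutes the residues modulo [k] and turns the condition d m = c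
    into d m = 1. *)
Lemma class_diff_sum0 (R : pzRingType) (k c d : nat) : (0 < k)%N -> coprime c k ->
  \sum_(0 <= m < k) class_diff R k c (d * m) = 0.
Proof.
move=> k0 ck; rewrite sumrB; apply/eqP; rewrite subr_eq0; apply/eqP.
rewrite !big_mkord; case: k k0 ck => // k _ ck.
have inj : injective (fun m : 'I_k.+1 => inord (c * m %% k.+1) : 'I_k.+1).
  move=> x y /(congr1 val) /=; rewrite !inordK ?ltn_pmod // => /eqP.
  by rewrite eqn_mod_coprime2l // !modn_small // => /eqP/val_inj.
rewrite (reindex_inj inj) /=; apply: eq_bigr => m _.
rewrite inordK ?ltn_pmod //; congr (nat_of_bool _)%:R.
by rewrite modnMmr mulnCA -{2}[c]muln1 eqn_mod_coprime2l.
Qed.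

Lemma class_diff_period (R : pzRingType) (k c s i : nat) :
  class_diff R k c (s + i * k) = class_diff R k c s.
Proof. by rewrite /class_diff addnC modnMDl. Qed.

Lemma norm_class_diff (R : realDomainType) (k c s : nat) : `|class_diff R k c s| <= 1.
Proof.
by rewrite /class_diff; case: eqP => _; case: eqP => _;
  rewrite ?subrr ?subr0 ?sub0r ?normrN ?normr1 ?normr0.
Qed.

Section ClassDifference.
Variables (R : rcfType) (X : nat -> bool) (k c : nat).
Hypothesis k0 : (0 < k)%N.
Hypothesis XM : forall a b, coprime a k -> coprime b k -> X (a * b)%N = X a (+) X b.
Hypothesis Xk : forall a, X (a + k)%N = X a.
Hypothesis ck : coprime c k.
Hypothesis Xc : ~~ X c.

(** The value is 1 or -1 even at numbers not prime to [k]; the factor [h], which vanishes outside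
    the classes of c and 1, removes these. *)
Let chi a : R := (-1) ^+ X a.
Let g := invsqrt R.
Let h := class_diff R k c.
Let F d m : R := chi d * h (d * m) * (g d * g m).

Let Xmod a : X (a %% k)%N = X a.
Proof.
rewrite {2}(divn_eq a k); elim: (a %/ k)%N => [|i IH]; first by rewrite mul0n add0n.
by rewrite mulSn -addnA addnC Xk.
Qed.

Let norm_chi a : `|chi a| = 1.
Proof. by rewrite normrX normrN1 expr1n. Qed.

(* On the support of h both d m = c and d m = 1 force chi d * chi m = 1. *)
Let chi_symm d m : chi d * h (d * m) = chi m * h (d * m).
Proof.
case: (boolP (coprime (d * m) k)) => [|ndm].
  rewrite coprimeMl => /andP[dk mk].
  case: (boolP ((d * m == c %[mod k]) || (d * m == 1 %[mod k])))%N => [E|].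
    have : X (d * m)%N = false.
      rewrite -Xmod; case/orP: E => /eqP ->; rewrite Xmod; first exact: negbTE.
      by have := XM (coprime1n k) (coprime1n k); rewrite muln1; case: X.
    by rewrite XM // /chi; case: (X d); case: (X m).
  by rewrite negb_or /h /class_diff => /andP[/negbTE -> /negbTE ->]; rewrite subrr !mulr0.
have nz e : coprime e k -> (d * m == e %[mod k])%N = false.
  by move=> ek; apply: contraNF ndm => /eqP E; rewrite -coprime_modl E coprime_modl.
by rewrite /h /class_diff !nz ?coprime1n // subrr !mulr0.
Qed.

Let F_symm d m : F d m = F m d.
Proof. by rewrite /F chi_symm mulnC [g d * _]mulrC. Qed.

Let gdec i : (1 <= i)%N -> g i.+1 <= g i.
Proof. exact: invsqrt_dec. Qed.
Let g_ge0 i : 0 <= g i.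
Proof. exact: invsqrt_ge0. Qed.

Let row_bound d u v : (0 < u)%N -> `|\sum_(u <= m < v) h (d * m) * g m| <= k%:R * g u.
Proof.
move=> u0; apply: (periodic_abel_bound (B := 1)) => //.
- by move=> i; rewrite mulnDr /h class_diff_period.
- exact: class_diff_sum0.
- by move=> i; apply: norm_class_diff.
- by move=> i /(leq_trans u0); apply: gdec.
Qed.

(** The row bound does not depend on the upper end, which may therefore vary with d; [invsqrt_sum]
    controls the sum over d. *)
Let tail_bound K (V : nat -> nat) :
  `|\sum_(1 <= d < K.+1) \sum_(K.+1 <= m < V d) F d m| <= k%:R * 2.
Proof.
apply: le_trans (ler_norm_sum _ _ _) _.
apply: (@le_trans _ _ (\sum_(1 <= d < K.+1) g d * (k%:R * g K.+1))).
  apply: ler_sum => d _.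
  rewrite (eq_bigr (fun m => (chi d * g d) * (h (d * m) * g m))); last first.
    by move=> m _; rewrite /F; ring.
  rewrite -mulr_sumr !normrM norm_chi mul1r (ger0_norm (g_ge0 d)).
  by apply: ler_wpM2l => //; apply: row_bound.
rewrite -mulr_suml mulrCA; apply: ler_wpM2l; first exact: ler0n.
exact: invsqrt_sum.
Qed.

Let square_bound K :
  `|\sum_(1 <= d < K.+1) \sum_(1 <= m < K.+1) F d m| <= (k * k)%:R.
Proof.
(* In this shape [chi m] factors out and |G m| <= k follows from [row_bound]. In [GE] it is traded
   for [chi d], so that G is periodic in m with sum zero over a period. *)
pose G m := \sum_(1 <= d < K.+1) chi m * h (m * d) * g d.
have -> : \sum_(1 <= d < K.+1) \sum_(1 <= m < K.+1) F d m = \sum_(1 <= m < K.+1) G m * g m.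
  apply: eq_bigr => m _; rewrite /G mulr_suml; apply: eq_bigr => d _.
  by rewrite /F -/g; ring.
have -> : (k * k)%:R = (k%:R *+ k) * g 1 :> R.
  by rewrite /g invsqrt1 mulr1 natrM mulr_natr.
have GE m : G m = \sum_(1 <= d < K.+1) chi d * g d * h (d * m).
  by apply: eq_bigr => d _; rewrite chi_symm mulnC; ring.
apply: periodic_abel_bound => //.
- move=> i; rewrite !GE; apply: eq_bigr => d _.
  by rewrite mulnDr /h class_diff_period.
- under eq_bigr do rewrite GE.
  rewrite exchange_big big1 //= => d _.
  by rewrite -mulr_sumr class_diff_sum0 // mulr0.
- move=> m; rewrite /G; under eq_bigr do rewrite -mulrA.
  rewrite -mulr_sumr normrM norm_chi mul1r.
  by apply: le_trans (row_bound _ _ _) _ => //; rewrite /g invsqrt1 mulr1.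
Qed.

(* The hyperbola method: F is symmetric and has zero sum over a period in either variable, so
   both tails and the square d, m <= K are bounded by Abel summation. *)
Lemma class_sum_diff_bound (K : nat) :
  `|\sum_(1 <= s < (K * K).+1) h s * g s * \sum_(d <- divisors s) chi d|
    <= (k * k)%:R + k%:R * 4.
Proof.
have -> : \sum_(1 <= s < (K * K).+1) h s * g s * \sum_(d <- divisors s) chi d =
    \sum_(1 <= d < (K * K).+1) \sum_(1 <= m < (K * K %/ d).+1) F d m.
  under eq_bigr do rewrite mulr_sumr.
  rewrite (sum_divisors_swap (fun d s => h s * g s * chi d) xpredT).
  apply: eq_bigr => d _; apply: eq_bigr => m _.
  by rewrite /F /g invsqrtM; ring.
have KK : (K.+1 <= (K * K).+1)%N by case: (K) => // K'; rewrite ltnS leq_pmulr.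
rewrite (big_cat_nat (n := K.+1)) //=.
have -> : \sum_(1 <= d < K.+1) \sum_(1 <= m < (K * K %/ d).+1) F d m =
    \sum_(1 <= d < K.+1) \sum_(1 <= m < K.+1) F d m +
    \sum_(1 <= d < K.+1) \sum_(K.+1 <= m < (K * K %/ d).+1) F d m.
  rewrite -big_split /= !big_nat; apply: eq_bigr => d /andP[d0 dK].
  by rewrite -(big_cat_nat (n := K.+1)) //= ltnS leq_divRL // leq_mul2l -ltnS dK orbT.
(* For d > K all cofactors m are at most K; exchanging d and m gives a tail of the same kind as
   before. *)
have -> : \sum_(K.+1 <= d < (K * K).+1) \sum_(1 <= m < (K * K %/ d).+1) F d m =
    \sum_(1 <= d < K.+1) \sum_(K.+1 <= m < (K * K %/ d).+1) F d m.
  transitivity (\sum_(K.+1 <= d < (K * K).+1) \sum_(1 <= m < K.+1 | (d * m <= K * K)%N) F d m).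
    rewrite !big_nat; apply: eq_bigr => d /andP[d0 dK].
    rewrite (big_nat_widen _ _ K.+1); last first.
      by rewrite ltnS -ltnS ltn_divLR; nia.
    by apply: eq_bigl => m; rewrite ltnS leq_divRL 1?mulnC //; lia.
  rewrite (exchange_big_dep predT) //= !big_nat; apply: eq_bigr => m /andP[m0 mK].
  rewrite [RHS](big_nat_widen _ _ (K * K).+1); last by rewrite ltnS leq_div.
  by apply: eq_big => [d|d _]; [rewrite /= ltnS leq_divRL|rewrite F_symm].
have := square_bound K; have := tail_bound K (fun d => (K * K %/ d).+1).
set A := \sum_(1 <= d < K.+1) _; set B := \sum_(1 <= d < K.+1) _ => HA HB.
apply: le_trans (ler_normD _ _) _.
have := ler_normD B A; lra.
Qed.

End ClassDifference.

(** * Values of the character sum *)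

Lemma divisors_prime_step (q e s : nat) : prime q -> coprime q s -> (0 < s)%N ->
  perm_eq (divisors (q ^ e.+1 * s))
    ([seq (q * d)%N | d <- divisors (q ^ e * s)] ++ divisors s).
Proof.
move=> pq qs s0; have q0 := prime_gt0 pq.
have N0 i : (0 < q ^ i * s)%N by rewrite muln_gt0 expn_gt0 q0 s0.
have qd d : (d %| s)%N -> ~~ (q %| d)%N.
  move=> ds; apply: contraL qs => /dvdn_trans/(_ ds) qds.
  by rewrite prime_coprime // negbK.
apply: uniq_perm; first exact: divisors_uniq.
  rewrite cat_uniq divisors_uniq map_inj_uniq ?divisors_uniq ?andbT; last first.
    by move=> x y /eqP; rewrite eqn_pmul2l // => /eqP.
  apply/hasPn => d; rewrite -dvdn_divisors // => ds; apply/mapP => -[x _ dE].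
  by move: (qd _ ds); rewrite dE dvdn_mulr.
move=> d; rewrite mem_cat -!dvdn_divisors //; apply/idP/orP.
  move=> dd; case: (boolP (q %| d)%N) => [/dvdnP[x dE]|nqd].
    left; apply/mapP; exists x; last by rewrite dE mulnC.
    by rewrite -dvdn_divisors // -(dvdn_pmul2r q0) -dE mulnC mulnA -expnS.
  right; move: dd; rewrite Gauss_dvdr //.
  by rewrite coprime_sym coprimeXl // prime_coprime.
case=> [/mapP[x]|ds]; last by rewrite dvdn_mull.
by rewrite -dvdn_divisors // => xd ->; rewrite expnS -mulnA dvdn_pmul2l.
Qed.

Definition char_sum (R : pzRingType) (X : nat -> bool) (s : nat) : R :=
  \sum_(d <- divisors s) (-1) ^+ X d.

(** The factor is 1 + chi(q) + ... + chi(q)^e. *)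
Lemma char_sum_prime_power (R : realDomainType) (X : nat -> bool) (k q e s : nat) :
  (forall a b, coprime a k -> coprime b k -> X (a * b)%N = X a (+) X b) ->
  prime q -> coprime q s -> (0 < s)%N -> coprime q k -> coprime s k ->
  char_sum R X (q ^ e * s) =
    (if X q then (~~ odd e)%:R else e.+1%:R) * char_sum R X s.
Proof.
move=> XM pq qs s0 qk sk; have q0 := prime_gt0 pq.
elim: e => [|e IH]; first by rewrite expn0 mul1n /=; case: (X q); rewrite mul1r.
rewrite {1}/char_sum (perm_big _ (divisors_prime_step e pq qs s0)) big_cat big_map /=.
have -> : \sum_(d <- divisors (q ^ e * s)) (-1) ^+ X (q * d)%N
    = (-1) ^+ X q * char_sum R X (q ^ e * s).
  rewrite /char_sum mulr_sumr !big_seq; apply: eq_bigr => d.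
  rewrite -dvdn_divisors ?muln_gt0 ?expn_gt0 ?q0 ?s0 // => dd.
  rewrite XM ?signr_addb //; apply: coprime_dvdl dd _.
  by rewrite coprimeMl coprimeXl.
rewrite IH -/(char_sum R X s) -[in X in _ + X](mul1r (char_sum R X s)) mulrA -mulrDl.
congr (_ * _); case: (X q) => /=; last by rewrite mul1r natr1.
by case: (odd e); rewrite ?mulr0 ?add0r // mulr1 expr1 addNr.
Qed.

(** Prime powers q^e are split off one at a time. If e is even, all of q^e goes into j^2. If e is
    odd, a nonzero sum forces chi(q) = 1 and one factor q is left in s0. The s0 so built is
    squarefree, so roots of -n modulo its primes are glued by Chinese remainders, with no lifting to
    prime powers. *)
Lemma char_sum_pos (R : realDomainType) (X : nat -> bool) (k n s : nat) :
  (forall a b, coprime a k -> coprime b k -> X (a * b)%N = X a (+) X b) ->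
  (forall q, prime q -> coprime q k -> ~~ X q -> exists t, (q %| t ^ 2 + n)%N) ->
  (0 < s)%N -> coprime s k ->
  [/\ 0 <= char_sum R X s,
      forall j, s = (j ^ 2)%N -> 1 <= char_sum R X s
    & char_sum R X s != 0 ->
      exists s0 j t, s = (s0 * j ^ 2)%N /\ (s0 %| t ^ 2 + n)%N].
Proof.
move=> XM Xq; elim/ltn_ind: s => s IH s0 sk.
case: (leqP s 1) => [s1|s1].
  have -> : s = 1%N by lia.
  have X1 : X 1%N = false by have := XM _ _ (coprime1n k) (coprime1n k); rewrite muln1; case: (X 1%N).
  have -> : char_sum R X 1 = 1 by rewrite /char_sum (_ : divisors 1 = [:: 1%N]) // big_seq1 X1.
  by split=> // _; exists 1%N, 1%N, 0%N.
have pq := pdiv_prime s1; set q := pdiv s in pq.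
have [s' qs' sE] := pfactor_coprime pq s0.
set e := logn q s in sE; rewrite mulnC in sE.
have e0 : (0 < e)%N by rewrite logn_gt0 mem_primes pq s0 pdiv_dvd.
have qk : coprime q k by apply: coprime_dvdl sk; apply: pdiv_dvd.
have s'k : coprime s' k by apply: coprime_dvdl sk; rewrite sE dvdn_mull.
have s'0 : (0 < s')%N by case: (s') sE s0 => //; lia.
have s's : (s' < s)%N by rewrite sE ltn_Pmull // -(exp1n e) ltn_exp2r // prime_gt1.
have [r0 rsq rex] := IH _ s's s'0 s'k.
rewrite sE (char_sum_prime_power R e XM pq qs' s'0 qk s'k).
split.
- by apply: mulr_ge0 => //; case: (X q).
- move=> j jE.
  have j0 : (0 < j)%N by case: (j) jE; lia.
  have [j' qj' j'E] := pfactor_coprime pq j0.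
  set f := logn q j in j'E.
  have ef : e = (f * 2)%N.
    have : logn q s = logn q (j ^ 2) by rewrite sE jE.
    by rewrite lognX mulnC.
  have s'E : s' = (j' ^ 2)%N.
    apply/eqP; rewrite -(eqn_pmul2l (m := q ^ e)) ?expn_gt0 ?prime_gt0 //.
    by rewrite jE j'E ef expnM expnMn mulnC.
  have := rsq _ s'E; case: (X q); last first.
    by move=> r1; apply: mulr_ege1 => //; rewrite ler1n.
  by rewrite ef muln2 odd_double mul1r.
- rewrite mulf_eq0 negb_or => /andP[Xqe /rex[s1' [j [t [s'E tE]]]]].
  have s1s' : (s1' %| s')%N by rewrite s'E dvdn_mulr.
  case: (boolP (odd e)) => eo; last first.
    exists s1', (q ^ e./2 * j)%N, t; split=> //.
    have -> : e = (e./2 * 2)%N by rewrite muln2 -[LHS]odd_double_half (negbTE eo).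
    by rewrite expnM expnMn s'E muln2 doubleK mulnCA.
  have [t1 t1E] : exists t, (q %| t ^ 2 + n)%N.
    by apply: Xq => //; move: Xqe; case: (X q) => //; rewrite eo eqxx.
  have cq : coprime q s1' by apply: coprime_dvdr s1s' qs'.
  exists (q * s1')%N, (q ^ e./2 * j)%N, (chinese q s1' t1 t); split.
    have -> : e = (e./2 * 2).+1%N by rewrite muln2 -[LHS]odd_double_half eo.
    by rewrite expnS expnM expnMn s'E /= muln2 uphalf_double; lia.
  rewrite Gauss_dvd //; apply/andP; split.
    by rewrite /dvdn -modnDml -modnXm chinese_modl // modnXm modnDml.
  by rewrite /dvdn -modnDml -modnXm chinese_modr // modnXm modnDml.
Qed.

Lemma sum_sub_le (R : numDomainType) (T : eqType) (s1 s2 : seq T) (f : T -> R) :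
  uniq s1 -> uniq s2 -> {subset s1 <= s2} -> (forall x, 0 <= f x) ->
  \sum_(x <- s1) f x <= \sum_(x <- s2) f x.
Proof.
move=> u1 u2 s12 f0.
rewrite [leRHS](bigID (mem s1)) /= -[X in _ <= X + _]big_filter.
have -> : \sum_(i <- [seq i <- s2 | i \in s1]) f i = \sum_(x <- s1) f x.
  apply: perm_big; apply: uniq_perm; rewrite ?filter_uniq // => x.
  by rewrite mem_filter; case: (boolP (x \in s1)) => // /s12.
by rewrite lerDl sumr_ge0.
Qed.

Lemma represented_in_class (R : rcfType) (X : nat -> bool) (k c n : nat) :
  (0 < k)%N ->
  (forall a b, coprime a k -> coprime b k -> X (a * b)%N = X a (+) X b) ->
  (forall a, X (a + k)%N = X a) ->
  (forall q, prime q -> coprime q k -> ~~ X q -> exists t, (q %| t ^ 2 + n)%N) ->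
  coprime c k -> ~~ X c ->
  exists s j t, [/\ (0 < s)%N, (s * j ^ 2 == c %[mod k])%N & (s %| t ^ 2 + n)%N].
Proof.
move=> k0 XM Xk Xq ck Xc.
(* The harmonic sum of 2^T terms is at least T / 2; divided by k this is one more than the bound of
   [class_sum_diff_bound]. With this [K], the squares of i k + 1 for i < 2^T are at most K^2. *)
pose T := (2 * k * (k * k + k * 4 + 1))%N.
pose K := (2 ^ T * k).+1.
pose D e : R := \sum_(1 <= s < (K * K).+1) (s == e %[mod k])%N%:R * (invsqrt R s * char_sum R X s).
have cop e s : coprime e k -> (s == e %[mod k])%N -> coprime s k.
  by move=> ek /eqP se; rewrite -coprime_modl se coprime_modl.
have term_ge0 e s : coprime e k -> (0 < s)%N ->
    0 <= (s == e %[mod k])%N%:R * (invsqrt R s * char_sum R X s).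
  move=> ek s0; case: (boolP (s == e %[mod k])%N) => se; last by rewrite mul0r.
  rewrite mul1r mulr_ge0 ?invsqrt_ge0 //.
  by case: (char_sum_pos R XM Xq s0 (cop _ _ ek se)).
have diff : `|D c - D 1%N| <= (k * k)%:R + k%:R * 4.
  rewrite -sumrB; apply: le_trans (class_sum_diff_bound R k0 XM Xk ck Xc K).
  rewrite le_eqVlt; apply/orP; left; apply/eqP; congr `|_|; apply: eq_bigr => s _.
  by rewrite /class_diff mulrBl mulrBl -!mulrA.
have D1 : (k * k)%:R + k%:R * 4 + 1 <= D 1%N.
  pose S := [seq ((i * k).+1 ^ 2)%N | i <- index_iota 0 (2 ^ T)].
  have S_inj : injective (fun i => ((i * k).+1 ^ 2)%N).
    by move=> x y /eqP; rewrite eqn_sqr eqSS eqn_pmul2r // => /eqP.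
  (* Absolute values, because [sum_sub_le] wants nonnegative terms at every natural number and
     [term_ge0] excludes s = 0. *)
  have SD : \sum_(s <- S) `|(s == 1 %[mod k])%N%:R * (invsqrt R s * char_sum R X s)| <= D 1%N.
    rewrite [leRHS](_ : _ = \sum_(1 <= s < (K * K).+1)
      `|(s == 1 %[mod k])%N%:R * (invsqrt R s * char_sum R X s)|); last first.
      rewrite /D !big_nat; apply: eq_bigr => s /andP[s0 _].
      by rewrite ger0_norm // term_ge0 ?coprime1n.
    apply: sum_sub_le => //; rewrite ?iota_uniq // ?map_inj_uniq ?iota_uniq //.
    move=> s /mapP[i]; rewrite !mem_index_iota => /andP[_ iT] ->.
    rewrite expn_gt0 /= ltnS -mulnn leq_mul // /K ltnS leq_pmul2r //; exact: ltnW.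
  apply: le_trans SD; rewrite /S big_map.
  (* The term at (i k + 1)^2 is at least 1 / (i k + 1), and i k + 1 <= k (i + 1). *)
  apply: (@le_trans _ _ (\sum_(0 <= i < 2 ^ T) (k%:R)^-1 * (i.+1%:R)^-1)); last first.
    apply: ler_sum => i _; have s0 : (0 < (i * k).+1 ^ 2)%N by rewrite expn_gt0.
    have s1 : ((i * k).+1 ^ 2 == 1 %[mod k])%N.
      by rewrite -modnXm -addn1 modnMDl modnXm exp1n.
    have [_ /(_ _ erefl) r1 _] := char_sum_pos R XM Xq s0 (cop _ _ (coprime1n k) s1).
    have g0 := invsqrt_ge0 R ((i * k).+1 ^ 2).
    rewrite s1 mul1r ger0_norm; last by rewrite mulr_ge0 // (le_trans _ r1).
    apply: le_trans (ler_wpM2l g0 r1); rewrite mulr1 -mulnn invsqrt_sq -invfM -natrM.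
    by rewrite lef_pV2 ?posrE ?ltr0n ?muln_gt0 ?k0 // ler_nat mulnS mulnC; lia.
  rewrite -mulr_sumr; apply: le_trans (ler_wpM2l _ (harmonic_lower R T)); last by rewrite invr_ge0.
  rewrite /T !natrM !natrD !natrM.
  have kn : k%:R != 0 :> R by rewrite pnatr_eq0 -lt0n.
  rewrite [leRHS](_ : _ = k%:R * k%:R + k%:R * 4 + 1) //; field; exact: kn.
have Dc : D c != 0.
  apply: lt0r_neq0; move: diff D1; set a := (k * k)%:R + _; set u := D c; set v := D 1%N.
  by rewrite ler_norml => /andP[]; lra.
have [s sI sn] : exists2 s, s \in index_iota 1 (K * K).+1 &
    (s == c %[mod k])%N%:R * (invsqrt R s * char_sum R X s) != 0.
  apply/hasP; apply: contraR Dc => /hasPn H; rewrite /D big_seq big1 // => s /H.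
  by rewrite negbK => /eqP.
have s0 : (0 < s)%N by move: sI; rewrite mem_index_iota => /andP[].
case: (boolP (s == c %[mod k])%N) sn => sc; last by rewrite mul0r eqxx.
rewrite mul1r mulf_eq0 negb_or => /andP[_ rs].
have [_ _ /(_ rs) [s' [j [t [sE st]]]]] := char_sum_pos R XM Xq s0 (cop _ _ ck sc).
exists s', j, t; split=> //; last by rewrite -sE.
by case: (s') sE s0 => // ->.
Qed.

(** * The three-square theorem *)

Local Open Scope nat_scope.

Lemma residues_exist (n : nat) : (n %% 4 == 1) || (n %% 4 == 2) || (n %% 8 == 3) ->
  exists s j t, [/\ 0 < s, odd s, s %| t ^ 2 + n &
    n %| (if n %% 8 == 3 then 2 * (s * j ^ 2) else s * j ^ 2).+1].
Proof.
move=> nE; have n0 : 0 < n by lia.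
have k0 : 0 < 8 * n by lia.
have [X [c [XM Xk Xq [ck Xc] nc]]] := quadratic_character nE.
have [s [j [t [s0 sc st]]]] := represented_in_class realalg k0 XM Xk Xq ck Xc.
have sjk : coprime (s * j ^ 2) (8 * n) by rewrite -coprime_modl (eqP sc) coprime_modl.
exists s, j, t; split=> //.
  move: sjk; rewrite coprimeMr => /andP[+ _].
  by rewrite (_ : 8 = 2 ^ 3) // coprime_pexpr // coprimen2 oddM => /andP[].
have sn : s * j ^ 2 = c %[mod n].
  by rewrite -(modn_dvdm (s * j ^ 2) (dvdn_mull 8 (dvdnn n))) (eqP sc) modn_dvdm // dvdn_mull.
have succ_cong a b : a = b %[mod n] -> n %| b.+1 -> n %| a.+1.
  by rewrite /dvdn -(addn1 a) -(addn1 b) -[(a + 1) %% n]modnDml => ->; rewrite modnDml.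
case: ifP nc => _; apply: succ_cong => //.
by rewrite -modnMmr sn modnMmr.
Qed.

Local Open Scope Z_scope.

Lemma Z_dvdn (a b : nat) : (a %| b)%N -> (Z.of_nat a | Z.of_nat b).
Proof. by move=> /dvdnP[q ->]; exists (Z.of_nat q); lia. Qed.

Lemma Zmod_of_nat (m k : nat) : Z.of_nat m mod Z.of_nat k = Z.of_nat (m %% k)%N.
Proof.
case: k => [|k]; first by rewrite Zmod_0_r modn0.
symmetry; apply: (Z.mod_unique_pos _ _ (Z.of_nat (m %/ k.+1)%N)).
  have := ltn_pmod m (ltn0Sn k); lia.
by rewrite {1}(divn_eq m k.+1); lia.
Qed.

Theorem three_squares (n : Z) : 0 < n ->
  n mod 4 = 1 \/ n mod 4 = 2 \/ n mod 8 = 3 ->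
  sum3sq n.
Proof.
move=> n0; have [m nm] : exists m, n = Z.of_nat m by exists (Z.to_nat n); lia.
rewrite {1 2 3}nm (Zmod_of_nat m 4) (Zmod_of_nat m 8) => nE.
have mE : ((m %% 4 == 1) || (m %% 4 == 2) || (m %% 8 == 3))%N by lia.
have [s [j [t [s0 so st ns]]]] := residues_exist mE.
have [r Hr] : (Z.of_nat s | Z.of_nat t * Z.of_nat t + n).
  have := Z_dvdn st; rewrite nm.
  by rewrite (_ : Z.of_nat (t ^ 2 + m) = Z.of_nat t * Z.of_nat t + Z.of_nat m) // -mulnn; lia.
have [v Hv] : exists v, Z.of_nat s = 2 * v + 1 by exists (Z.of_nat s./2); lia.
case m8: (m %% 8 == 3)%N ns; rewrite -mulnn => ns; have [q Hq] := Z_dvdn ns.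
- pose s2 := 2 * Z.of_nat s; pose J := Z.of_nat j.
  have Hq' : s2 * J * J + 1 = q * n by rewrite nm -Hq /s2 /J; lia.
  (* Here 2 s replaces s, so the root of -n must hold modulo 2 s. As n is odd the root has to be
     odd; adding the odd number s corrects an even one. *)
  have [T [[a Ha] [r' Hr']]] : exists T, (exists a, T = 2 * a + 1) /\ (Z.of_nat s | T * T + n).
    case to: (odd t).
      by exists (Z.of_nat t); split; [exists (Z.of_nat t./2); lia | exists r].
    exists (Z.of_nat t + Z.of_nat s); split.
      by exists (Z.of_nat t./2 + v); lia.
    exists (r + 2 * Z.of_nat t + Z.of_nat s).
    transitivity (r * Z.of_nat s + (2 * Z.of_nat t + Z.of_nat s) * Z.of_nat s); last by ring.
    by rewrite -Hr; ring.
  have [b Hb] : exists b, n = 2 * b + 1 by exists (Z.of_nat m./2); lia.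
  apply: (@three_squares_of_residues n s2 T (s2 * J)) => //; first by rewrite /s2; lia.
  + apply: bezout_rel_prime; apply: (@Bezout_intro _ _ _ (- (J * J)) q).
    by rewrite -Hq'; ring.
  + pose w := 2 * a * a + 2 * a + b + 1.
    have Hw : T * T + n = 2 * w by rewrite Ha Hb /w; ring.
    exists (w - r' * v); rewrite Hw /s2.
    have Hr2 : r' * Z.of_nat s = 2 * w by rewrite -Hr'.
    have Hr3 : r' = 2 * (w - r' * v) by move: Hr2; rewrite Hv; lia.
    by rewrite -Hr2 {1}Hr3; ring.
  + by exists (s2 * q); transitivity (s2 * (q * n)); [rewrite -Hq'|]; ring.
- pose S := Z.of_nat s; pose J := Z.of_nat j.
  have Hq' : S * J * J + 1 = q * n by rewrite nm -Hq /S /J; lia.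
  apply: (@three_squares_of_residues n S (Z.of_nat t) (S * J)) => //; first by rewrite /S; lia.
  + apply: bezout_rel_prime; apply: (@Bezout_intro _ _ _ (- (J * J)) q).
    by rewrite -Hq'; ring.
  + by exists r.
  + by exists (S * q); transitivity (S * (q * n)); [rewrite -Hq'|]; ring.
Qed.

(** * Representations with congruence conditions *)

Definition odd_Z (a : Z) : Prop := exists k, a = 2 * k + 1.
Definition even_Z (a : Z) : Prop := exists k, a = 2 * k.
Definition coprime3 (a : Z) : Prop := exists k, a = 3 * k + 1 \/ a = 3 * k - 1.

Lemma parity_cases (a : Z) : even_Z a \/ odd_Z a.
Proof. exact (Z.Even_or_Odd a). Qed.

Lemma odd_sqr (a : Z) : odd_Z a -> exists m, a * a = 8 * m + 1.
Proof.
intros [k ->]; destruct (parity_cases k) as [[j ->]|[j ->]].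
- exists (2 * j * j + j); lia.
- exists (2 * j * j + 3 * j + 1); lia.
Qed.

Lemma odd_sqr_form (a b m : Z) : a * a + 2 * (b * b) = 8 * m + 3 -> odd_Z a /\ odd_Z b.
Proof.
intros H; destruct (parity_cases a) as [[j ->]|Ha]; [exfalso; lia|].
split; [exact Ha|]; destruct (odd_sqr Ha) as [i Hi].
destruct (parity_cases b) as [[j ->]|Hb]; [exfalso; lia|exact Hb].
Qed.

Lemma odd_even_sqr_form (a b m : Z) : a * a + 2 * (b * b) = 8 * m + 1 -> odd_Z a /\ even_Z b.
Proof.
intros H; destruct (parity_cases a) as [[j ->]|Ha]; [exfalso; lia|].
split; [exact Ha|]; destruct (odd_sqr Ha) as [i Hi].
destruct (parity_cases b) as [Hb|Hb]; [exact Hb|exfalso].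
destruct (odd_sqr Hb); lia.
Qed.

Lemma mod3_cases (a : Z) :
  (exists k, a = 3 * k) \/ (coprime3 a /\ exists m, a * a = 3 * m + 1).
Proof.
assert (H : exists k, a = 3 * k \/ a = 3 * k + 1 \/ a = 3 * k - 1).
{ pose proof (Z.div_mod a 3 ltac:(lia)); pose proof (Z.mod_pos_bound a 3 ltac:(lia)).
  destruct (Z.eq_dec (a mod 3) 2); [exists (a / 3 + 1)|exists (a / 3)]; lia. }
destruct H as [k [->|[->| ->]]]; [left; eauto|right..].
- split; [exists k; auto|exists (3 * k * k + 2 * k); lia].
- split; [exists k; auto|exists (3 * k * k - 2 * k); lia].
Qed.

Lemma coprime3_sqr (a : Z) : coprime3 a -> exists m, a * a = 3 * m + 1.
Proof.
intros [k [->| ->]]; [exists (3 * k * k + 2 * k)|exists (3 * k * k - 2 * k)]; lia.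
Qed.

Lemma coprime3_of_sqr (a m : Z) : a * a = 3 * m + 1 -> coprime3 a.
Proof. intros H; destruct (mod3_cases a) as [[k ->]|[Ha _]]; [exfalso; lia|exact Ha]. Qed.

Lemma coprime3_of_mul2 (a : Z) : coprime3 (2 * a) -> coprime3 a.
Proof.
intros [k [H|H]]; destruct (parity_cases k) as [[j ->]|[j ->]]; try (exfalso; lia).
- exists (j + 1); lia.
- exists j; lia.
Qed.

Lemma coprime3_mul2 (a : Z) : coprime3 a -> coprime3 (2 * a).
Proof. intros [k [->| ->]]; [exists (2 * k + 1)|exists (2 * k - 1)]; lia. Qed.

Lemma coprime3_add_or_sub (a b : Z) : coprime3 a \/ coprime3 b ->
  coprime3 (a + b) \/ coprime3 (a - b).
Proof.
intros H.
assert (H' : exists i j, (a = 3 * i \/ a = 3 * i + 1 \/ a = 3 * i - 1) /\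
  (b = 3 * j \/ b = 3 * j + 1 \/ b = 3 * j - 1) /\ ~ (a = 3 * i /\ b = 3 * j)).
{ destruct H as [[i Hi]|[j Hj]].
  - destruct (mod3_cases b) as [[j Hj]|[[j Hj] _]]; exists i, j; lia.
  - destruct (mod3_cases a) as [[i Hi]|[[i Hi] _]]; exists i, j; lia. }
destruct H' as (i & j & [->|[->| ->]] & [->|[->| ->]] & Hn); try (exfalso; lia);
  first [left; exists (i + j); lia
    | right; exists (i - j + 1); lia | right; exists (i - j - 1); lia
    | left; exists (i + j + 1); lia | left; exists (i + j - 1); lia].
Qed.

(** Modulo 3 the hypothesis says a = b or a = -b, so a + b sqrt(-2) is divisible by 1 + sqrt(-2) or
    by its conjugate, both of norm 3. *)
Lemma norm_div3 (a b k : Z) : a * a + 2 * (b * b) = 3 * k ->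
  exists c d, c * c + 2 * (d * d) = k.
Proof.
intros H.
destruct (mod3_cases a) as [[i ->]|[[i Hi] [m Hm]]];
  destruct (mod3_cases b) as [[j ->]|[[j Hj] [m' Hm']]]; try (exfalso; lia).
- exists (i + 2 * j), (i - j); lia.
- destruct Hi as [->| ->], Hj as [->| ->].
  + exists (i + 2 * j + 1), (i - j); lia.
  + exists (i - 2 * j + 1), (i + j); lia.
  + exists (i - 2 * j - 1), (i + j); lia.
  + exists (i + 2 * j - 1), (i - j); lia.
Qed.

(* Multiply c + d sqrt(-2) by 1 + sqrt(-2) or by its conjugate. *)
Lemma norm_mul3_coprime (c d : Z) : coprime3 c \/ coprime3 d ->
  exists a b, coprime3 a /\ coprime3 b /\ a * a + 2 * (b * b) = 3 * (c * c + 2 * (d * d)).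
Proof.
intros H; destruct (coprime3_add_or_sub H) as [[k Hk]|[k Hk]].
- exists (c - 2 * d), (c + d); repeat split; [exists (k - d)|exists k|]; lia.
- exists (c + 2 * d), (c - d); repeat split; [exists (k + d)|exists k|]; lia.
Qed.

(** Divide by an element of norm 3. If both coordinates of the quotient are divisible by 3, its norm
    k is again of the form 3 k' with k' < k, and induction supplies a better quotient. Multiplying
    back by the right conjugate keeps both coordinates prime to 3. *)
Lemma norm3_coprime (k : Z) : 0 < k -> forall a b, a * a + 2 * (b * b) = 3 * k ->
  exists c d, coprime3 c /\ coprime3 d /\ c * c + 2 * (d * d) = 3 * k.
Proof.
intros Hk; assert (H0 : 0 <= k) by lia; revert Hk; pattern k; apply Z_lt_induction; [|exact H0].
clear k H0; intros k IH Hk a b Hab.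
destruct (norm_div3 Hab) as (c & d & Hcd).
assert (E : exists c d, (coprime3 c \/ coprime3 d) /\ c * c + 2 * (d * d) = k).
{ destruct (mod3_cases c) as [[i ->]|[Hc _]]; [|exists c, d; auto].
  destruct (mod3_cases d) as [[j ->]|[Hd _]]; [|exists (3 * i), d; auto].
  destruct (IH (3 * (i * i + 2 * (j * j))) ltac:(lia) ltac:(lia) (3 * i) (3 * j) ltac:(lia))
    as (c & d & Hc & Hd & E).
  exists c, d; split; [auto|lia]. }
destruct E as (c' & d' & H & <-).
exact (norm_mul3_coprime H).
Qed.

Lemma square_cases (n : Z) : (exists w, n = w * w) \/ (forall w, n <> w * w).
Proof.
destruct (Z.eq_dec n (Z.sqrt n * Z.sqrt n)) as [E|E]; [left; eauto|right].
intros w ->; apply E; rewrite <- (Z.abs_square w) at 2.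
rewrite <- Z.abs_square, Z.sqrt_square; lia.
Qed.

Lemma div_mod_cases (n m : Z) : 0 < m -> exists q r, n = m * q + r /\ 0 <= r < m.
Proof.
intros Hm; exists (n / m), (n mod m); split; [apply Z.div_mod; lia|apply Z.mod_pos_bound; lia].
Qed.

(** * Ternary forms from sums of three squares *)

Lemma three_squares_1_mod4 (k : Z) : 0 <= k ->
  exists a b c, 4 * k + 1 = a * a + 4 * (b * b) + 4 * (c * c) /\ odd_Z a.
Proof.
intros Hk.
destruct (@three_squares (4 * k + 1)) as (x & y & z & E); [lia|left|].
{ symmetry; apply (Z.mod_unique_pos _ _ k); lia. }
destruct (parity_cases x) as [[i ->]|Hx]; [|destruct (odd_sqr Hx)];
  (destruct (parity_cases y) as [[j ->]|Hy]; [|destruct (odd_sqr Hy)]);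
  (destruct (parity_cases z) as [[l ->]|Hz]; [|destruct (odd_sqr Hz)]);
  try (exfalso; lia).
- exists z, i, j; split; [lia|exact Hz].
- exists y, i, l; split; [lia|exact Hy].
- exists x, j, l; split; [lia|exact Hx].
Qed.

Lemma three_squares_2_mod4 (k : Z) : 0 <= k ->
  exists a b c, 4 * k + 2 = a * a + b * b + 4 * (c * c) /\ odd_Z a /\ odd_Z b.
Proof.
intros Hk.
destruct (@three_squares (4 * k + 2)) as (x & y & z & E); [lia|right; left|].
{ symmetry; apply (Z.mod_unique_pos _ _ k); lia. }
destruct (parity_cases x) as [[i ->]|Hx]; [|destruct (odd_sqr Hx)];
  (destruct (parity_cases y) as [[j ->]|Hy]; [|destruct (odd_sqr Hy)]);
  (destruct (parity_cases z) as [[l ->]|Hz]; [|destruct (odd_sqr Hz)]);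
  try (exfalso; lia).
- exists y, z, i; split; [lia|auto].
- exists x, z, j; split; [lia|auto].
- exists x, y, l; split; [lia|auto].
Qed.

Lemma sum3sq_1_mod4 (k : Z) : 0 <= k -> sum3sq (4 * k + 1).
Proof.
intros H; apply three_squares; [lia|left].
symmetry; apply (Z.mod_unique_pos _ _ k); lia.
Qed.

Lemma sum3sq_2_mod4 (k : Z) : 0 <= k -> sum3sq (4 * k + 2).
Proof.
intros H; apply three_squares; [lia|right; left].
symmetry; apply (Z.mod_unique_pos _ _ k); lia.
Qed.

Lemma sum3sq_3_mod8 (k : Z) : 0 <= k -> sum3sq (8 * k + 3).
Proof.
intros H; apply three_squares; [lia|right; right].
symmetry; apply (Z.mod_unique_pos _ _ k); lia.
Qed.

Lemma sum3sq_mul4 (n : Z) : sum3sq n -> sum3sq (4 * n).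
Proof. intros (x & y & z & ->); exists (2 * x), (2 * y), (2 * z); ring. Qed.

Lemma form112_of_double (k : Z) : sum3sq k -> exists x y z, 2 * k = x * x + y * y + 2 * (z * z).
Proof. intros (x & y & z & ->); exists (x + y), (x - y), z; ring. Qed.

(** Twice an odd number is 2 modulo 4, hence a sum of two odd squares and an even one; halve it. *)
Lemma form112_odd (m : Z) : 0 < m -> odd_Z m -> exists x y z, m = x * x + y * y + 2 * (z * z).
Proof.
intros Hm [k ->].
destruct (@three_squares_2_mod4 k ltac:(lia)) as (a & b & c & E & [i ->] & [j ->]).
exists (i + j + 1), (i - j), c; lia.
Qed.

(** Two of the three integers have equal parity; their half sum and half difference are the new
    variables. *)
Lemma form122 (k : Z) : sum3sq k -> exists x y z, k = x * x + 2 * (y * y) + 2 * (z * z).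
Proof.
intros (x & y & z & ->).
destruct (parity_cases x) as [[i ->]|[i ->]];
  destruct (parity_cases y) as [[j ->]|[j ->]].
- exists z, (i + j), (i - j); ring.
- destruct (parity_cases z) as [[l ->]|[l ->]].
  + exists (2 * j + 1), (i + l), (i - l); ring.
  + exists (2 * i), (j + l + 1), (j - l); ring.
- destruct (parity_cases z) as [[l ->]|[l ->]].
  + exists (2 * i + 1), (j + l), (j - l); ring.
  + exists (2 * j), (i + l + 1), (i - l); ring.
- exists z, (i + j + 1), (i - j); ring.
Qed.

(** Modulo 3, either all variables are prime to 3 or only x or only y is. In the latter case the
    other two form a pair of norm divisible by 3, nonzero since k is no square, which
    [norm3_coprime] replaces. *)
Lemma form112_coprime3 (k m : Z) : 0 < k -> k = 3 * m + 1 -> (forall w, k <> w * w) ->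
  (exists x y z, k = x * x + y * y + 2 * (z * z)) ->
  exists a b c, k = a * a + b * b + 2 * (c * c) /\ coprime3 a /\ coprime3 b /\ coprime3 c.
Proof.
intros Hk Hm Hw (x & y & z & E).
assert (fix_pair : forall x y z, k = x * x + y * y + 2 * (z * z) ->
    (exists j, y = 3 * j) -> (exists l, z = 3 * l) -> coprime3 x ->
  exists a b c, k = a * a + b * b + 2 * (c * c) /\ coprime3 a /\ coprime3 b /\ coprime3 c).
{ clear x y z E; intros x y z E [j ->] [l ->] Hx.
  destruct (@norm3_coprime (3 * (j * j + 2 * (l * l)))) with (a := 3 * j) (b := 3 * l)
    as (b & c & Hb & Hc & F); [|lia|].
  - destruct (Z.eq_dec j 0) as [->|]; destruct (Z.eq_dec l 0) as [->|]; try nia.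
    exfalso; apply (Hw x); lia.
  - exists x, b, c; repeat split; auto; lia. }
destruct (mod3_cases x) as [Hx|[Hx [i Hi]]]; destruct (mod3_cases y) as [Hy|[Hy [j Hj]]];
  destruct (mod3_cases z) as [Hz|[Hz [l Hl]]].
- destruct Hx as [i ->], Hy as [j ->], Hz as [l ->]; exfalso; lia.
- destruct Hx as [i ->], Hy as [j ->]; exfalso; lia.
- apply (fix_pair y x z); auto; lia.
- destruct Hx as [i ->]; exfalso; lia.
- apply (fix_pair x y z); auto.
- destruct Hy as [j ->]; exfalso; lia.
- destruct Hz as [l ->]; exfalso; lia.
- exists x, y, z; auto.
Qed.

(** As in [form112_coprime3], but a variable that alone is prime to 3 now has coefficient 2. *)
Lemma form122_coprime3 (k m : Z) : 0 < k -> k = 3 * m + 2 -> (forall w, k <> 2 * (w * w)) ->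
  sum3sq k ->
  exists a b c, k = a * a + 2 * (b * b) + 2 * (c * c) /\ coprime3 a /\ coprime3 b /\ coprime3 c.
Proof.
intros Hk Hm Hw H; destruct (form122 H) as (x & y & z & E); clear H.
assert (fix_pair : forall x y z, k = x * x + 2 * (y * y) + 2 * (z * z) ->
    (exists j, x = 3 * j) -> (exists l, z = 3 * l) -> coprime3 y ->
  exists a b c, k = a * a + 2 * (b * b) + 2 * (c * c) /\ coprime3 a /\ coprime3 b /\ coprime3 c).
{ clear x y z E; intros x y z E [j ->] [l ->] Hx.
  destruct (@norm3_coprime (3 * (j * j + 2 * (l * l)))) with (a := 3 * j) (b := 3 * l)
    as (b & c & Hb & Hc & F); [|lia|].
  - destruct (Z.eq_dec j 0) as [->|]; destruct (Z.eq_dec l 0) as [->|]; try nia.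
    exfalso; apply (Hw y); lia.
  - exists b, y, c; repeat split; auto; lia. }
destruct (mod3_cases x) as [Hx|[Hx [i Hi]]]; destruct (mod3_cases y) as [Hy|[Hy [j Hj]]];
  destruct (mod3_cases z) as [Hz|[Hz [l Hl]]].
- destruct Hx as [i ->], Hy as [j ->], Hz as [l ->]; exfalso; lia.
- apply (fix_pair x z y); auto; lia.
- apply (fix_pair x y z); auto.
- destruct Hx as [i ->]; exfalso; lia.
- destruct Hy as [j ->], Hz as [l ->]; exfalso; lia.
- destruct Hy as [j ->]; exfalso; lia.
- destruct Hz as [l ->]; exfalso; lia.
- exists x, y, z; auto.
Qed.

(** * Quaternary forms with variables prime to 3 *)

Lemma square_mod4 (w : Z) : exists m, w * w = 4 * m \/ w * w = 8 * m + 1.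
Proof.
destruct (parity_cases w) as [[j ->]|H]; [exists (j * j); lia|].
destruct (odd_sqr H) as [m E]; exists m; auto.
Qed.

(** Multiples of 4 descend, as doubling keeps variables prime to 3. For odd N only squares obstruct
    h = 0, and then N - 18 = 7 modulo 8 is no square. For N = 2 modulo 4, h = 1 is used when N / 2 =
    7 modulo 8. *)
Lemma form_18_1_1_2 (N : Z) : 4 <= N -> (exists n, N = 3 * n + 1) ->
  exists h a b c, N = 18 * (h * h) + a * a + b * b + 2 * (c * c) /\
    coprime3 a /\ coprime3 b /\ coprime3 c.
Proof.
intros HN; assert (H0 : 0 <= N) by lia; revert HN; pattern N; apply Z_lt_induction; [|exact H0].
clear N H0; intros N IH HN [n Hn].
assert (shift : forall h, (exists a b c, N - 18 * (h * h) = a * a + b * b + 2 * (c * c) /\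
    coprime3 a /\ coprime3 b /\ coprime3 c) -> exists h a b c,
    N = 18 * (h * h) + a * a + b * b + 2 * (c * c) /\ coprime3 a /\ coprime3 b /\ coprime3 c).
{ intros h (a & b & c & E & H); exists h, a, b, c; split; [lia|exact H]. }
destruct (@div_mod_cases N 4 ltac:(lia)) as (q & r & Hq & Hr).
destruct (Z.eq_dec r 0) as [E0|E0].
{ destruct (Z.eq_dec N 4) as [->|N4].
  - exists 0, 1, 1, 1; repeat split; try lia; exists 0; lia.
  - destruct (IH q ltac:(lia) ltac:(lia)) as (h & a & b & c & E & Ha & Hb & Hc).
    { exists (n - q); lia. }
    exists (2 * h), (2 * a), (2 * b), (2 * c); repeat split; try (apply coprime3_mul2; assumption).
    lia. }
destruct (Z.eq_dec r 2) as [E2|E2].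
{ assert (P : forall h j, sum3sq j -> 2 * j = N - 18 * (h * h) -> 0 < j -> (forall w, 2 * j <> w * w) ->
    exists h a b c, N = 18 * (h * h) + a * a + b * b + 2 * (c * c) /\
    coprime3 a /\ coprime3 b /\ coprime3 c).
  { intros h j Hs Hj Hp Hw; apply (shift h); rewrite <- Hj.
    apply (@form112_coprime3 _ (n - 6 * (h * h))); [lia|lia|exact Hw|apply form112_of_double, Hs]. }
  destruct (@div_mod_cases q 4 ltac:(lia)) as (p & s & Hp & Hs).
  assert (Hs' : s = 0 \/ s = 2 \/ s = 1 \/ s = 3) by lia.
  destruct Hs' as [-> |[-> |[-> | ->]]].
  - apply (P 0 (4 * (2 * p) + 1)); [apply sum3sq_1_mod4| | |intros w Hw; destruct (square_mod4 w)]; lia.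
  - apply (P 0 (4 * (2 * p + 1) + 1)); [apply sum3sq_1_mod4| | |intros w Hw; destruct (square_mod4 w)]; lia.
  - apply (P 0 (8 * p + 3)); [apply sum3sq_3_mod8| | |intros w Hw; destruct (square_mod4 w)]; lia.
  - apply (P 1 (4 * (2 * p - 1) + 2)); [apply sum3sq_2_mod4| | |intros w Hw]; try lia.
    destruct (parity_cases w) as [[v ->]|Ho]; [destruct (square_mod4 v)|destruct (odd_sqr Ho)]; lia. }
assert (No : exists i, N = 2 * i + 1).
{ assert (Hr' : r = 1 \/ r = 3) by lia.
  destruct Hr' as [-> | ->]; [exists (2 * q)|exists (2 * q + 1)]; lia. }
destruct No as [i Hi].
destruct (square_cases N) as [[w Hw]|Hw].
- assert (Hw25 : 25 <= w * w) by (destruct (square_mod4 w) as [m [|]]; lia).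
  apply (shift 1); apply (@form112_coprime3 _ (n - 6)); try lia.
  + intros v Hv; destruct (square_mod4 w), (square_mod4 v); lia.
  + apply form112_odd; [lia|exists (i - 9); lia].
- apply (shift 0); apply (@form112_coprime3 _ n); try lia.
  + intros v; replace (N - 18 * (0 * 0)) with N by lia; apply Hw.
  + apply form112_odd; [lia|exists i; lia].
Qed.

(** Multiples of 4 descend. Otherwise h = 0, except that h = 1 is used when N = 7 modulo 8 or N is
    twice a square; then N - 9 is 6 modulo 8 or 1 modulo 4. *)
Lemma form_9_1_2_2 (N : Z) : 5 <= N -> (exists n, N = 3 * n + 2) ->
  exists h a b c, N = 9 * (h * h) + a * a + 2 * (b * b) + 2 * (c * c) /\
    coprime3 a /\ coprime3 b /\ coprime3 c.
Proof.
intros HN; assert (H0 : 0 <= N) by lia; revert HN; pattern N; apply Z_lt_induction; [|exact H0].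
clear N H0; intros N IH HN [n Hn].
destruct (@div_mod_cases N 8 ltac:(lia)) as (q & r & Hq & Hr).
assert (P : forall h j, sum3sq j -> j = N - 9 * (h * h) -> 0 < j -> (forall w, j <> 2 * (w * w)) ->
    exists h a b c, N = 9 * (h * h) + a * a + 2 * (b * b) + 2 * (c * c) /\
    coprime3 a /\ coprime3 b /\ coprime3 c).
{ intros h j Hs Hj Hp Hw.
  destruct (@form122_coprime3 j (n - 3 * (h * h))) as (a & b & c & E & H); auto; [lia|].
  exists h, a, b, c; split; [lia|exact H]. }
assert (Hr' : r = 0 \/ r = 4 \/ r = 2 \/ r = 6 \/ r = 1 \/ r = 5 \/ r = 3 \/ r = 7) by lia.
assert (P4 : forall j, N = 4 * j -> exists h a b c,
  N = 9 * (h * h) + a * a + 2 * (b * b) + 2 * (c * c) /\ coprime3 a /\ coprime3 b /\ coprime3 c).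
{ intros j Hj; destruct (Z.eq_dec j 2) as [->|].
  - exists 0, 2, 1, 1; repeat split; [lia|exists 1|exists 0|exists 0]; lia.
  - destruct (IH j ltac:(lia) ltac:(lia)) as (h & a & b & c & E & Ha & Hb & Hc).
    { exists (n - j); lia. }
    exists (2 * h), (2 * a), (2 * b), (2 * c); repeat split; try (apply coprime3_mul2; assumption).
    lia. }
assert (P2 : forall j, N = 4 * j + 2 -> exists h a b c,
  N = 9 * (h * h) + a * a + 2 * (b * b) + 2 * (c * c) /\ coprime3 a /\ coprime3 b /\ coprime3 c).
{ intros j Hj; destruct (square_cases (2 * j + 1)) as [[w Hw]|Hw].
  - destruct (square_mod4 w) as [m [Hm|Hm]]; [lia|].
    apply (P 1 (4 * (4 * m - 2) + 1)); [apply sum3sq_1_mod4| | |intros v]; lia.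
  - apply (P 0 (4 * j + 2)); [apply sum3sq_2_mod4| | |intros v Hv; apply (Hw v)]; lia. }
destruct Hr' as [-> |[-> |[-> |[-> |[-> |[-> |[-> | ->]]]]]]].
- apply (P4 (2 * q)); lia.
- apply (P4 (2 * q + 1)); lia.
- apply (P2 (2 * q)); lia.
- apply (P2 (2 * q + 1)); lia.
- apply (P 0 (4 * (2 * q) + 1)); [apply sum3sq_1_mod4| | |intros v]; lia.
- apply (P 0 (4 * (2 * q + 1) + 1)); [apply sum3sq_1_mod4| | |intros v]; lia.
- apply (P 0 (8 * q + 3)); [apply sum3sq_3_mod8| | |intros v]; lia.
- apply (P 1 (4 * (2 * q - 1) + 2)); [apply sum3sq_2_mod4| | |intros v Hv]; try lia.
  destruct (square_mod4 v); lia.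
Qed.

(** Exactly one of the three squares is prime to 3; adding and subtracting a multiple of 3 keeps it
    so. *)
Lemma form_18_1_1_of_sum3sq (k m : Z) : k = 3 * m + 1 -> sum3sq k ->
  exists h a b, 2 * k = 18 * (h * h) + a * a + b * b /\ coprime3 a /\ coprime3 b.
Proof.
intros Hm (x & y & z & E).
assert (P : forall x i j, k = x * x + 3 * i * (3 * i) + 3 * j * (3 * j) -> coprime3 x ->
  exists h a b, 2 * k = 18 * (h * h) + a * a + b * b /\ coprime3 a /\ coprime3 b).
{ clear; intros x i j E [l Hl]; exists j, (x + 3 * i), (x - 3 * i); repeat split; [lia|..].
  - exists (l + i); lia.
  - exists (l - i); lia. }
destruct (mod3_cases x) as [[i ->]|[Hx [i Hi]]]; destruct (mod3_cases y) as [[j ->]|[Hy [j Hj]]];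
  destruct (mod3_cases z) as [[l ->]|[Hz [l Hl]]]; try (exfalso; lia).
- apply (P z i j); auto; lia.
- apply (P y i l); auto; lia.
- apply (P x j l); auto; lia.
Qed.

(* The variable c is taken in {1, 2, 4, 5, 7} so that (N - 3 c^2) / 2, up to a factor 4, is 1 or 2
   modulo 4 or 3 modulo 8; the explicit values are those N too small for the required c. *)
Lemma form_18_1_1_3 (N : Z) : 5 <= N -> (exists n, N = 3 * n + 2) ->
  exists h a b c, N = 18 * (h * h) + a * a + b * b + 3 * (c * c) /\
    coprime3 a /\ coprime3 b /\ coprime3 c.
Proof.
intros HN; assert (H0 : 0 <= N) by lia; revert HN; pattern N; apply Z_lt_induction; [|exact H0].
clear N H0; intros N IH HN [n Hn].
assert (c3 : coprime3 1 /\ coprime3 2 /\ coprime3 4 /\ coprime3 5 /\ coprime3 7 /\ coprime3 8).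
{ repeat split; [exists 0|exists 1|exists 1|exists 2|exists 2|exists 3]; lia. }
destruct c3 as (c1 & c2 & c4 & c5 & c7 & c8).
assert (P : forall w j, sum3sq j -> coprime3 w -> 2 * j = N - 3 * (w * w) -> exists h a b c,
  N = 18 * (h * h) + a * a + b * b + 3 * (c * c) /\ coprime3 a /\ coprime3 b /\ coprime3 c).
{ intros w j Hs Hw Hj.
  destruct (coprime3_sqr Hw) as [m Hm].
  assert (Hj' : exists i, j = 3 * i + 1) by (exists (j - n + 3 * m); lia).
  destruct Hj' as [i Hi].
  destruct (form_18_1_1_of_sum3sq Hi Hs) as (h & a & b & E & Ha & Hb).
  exists h, a, b, w; repeat split; auto; lia. }
assert (P4 : forall w j, sum3sq j -> coprime3 w -> 8 * j = N - 3 * (w * w) -> exists h a b c,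
  N = 18 * (h * h) + a * a + b * b + 3 * (c * c) /\ coprime3 a /\ coprime3 b /\ coprime3 c).
{ intros w j Hs Hw Hj; apply (P w (4 * j)); [apply sum3sq_mul4, Hs|exact Hw|lia]. }
destruct (@div_mod_cases N 8 ltac:(lia)) as (q & r & Hq & Hr).
assert (Hr' : r = 0 \/ r = 4 \/ r = 2 \/ r = 6 \/ r = 1 \/ r = 5 \/ r = 3 \/ r = 7) by lia.
assert (PM4 : forall j, N = 4 * j -> exists h a b c,
  N = 18 * (h * h) + a * a + b * b + 3 * (c * c) /\ coprime3 a /\ coprime3 b /\ coprime3 c).
{ intros j Hj; destruct (Z.eq_dec j 2) as [->|].
  - exists 0, 1, 2, 1; repeat split; auto; lia.
  - destruct (IH j ltac:(lia) ltac:(lia)) as (h & a & b & c & E & Ha & Hb & Hc).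
    { exists (n - j); lia. }
    exists (2 * h), (2 * a), (2 * b), (2 * c); repeat split; try (apply coprime3_mul2; assumption).
    lia. }
destruct Hr' as [-> |[-> |[-> |[-> |[-> |[-> |[-> | ->]]]]]]].
- apply (PM4 (2 * q)); lia.
- apply (PM4 (2 * q + 1)); lia.
- destruct (Z_lt_ge_dec q 6) as [Hlt|Hge].
  + assert (E : q = 3) by lia.
    exists 1, 1, 2, 1; repeat split; auto; lia.
  + apply (P 4 (4 * (q - 6) + 1)); [apply sum3sq_1_mod4| |]; auto; lia.
- apply (P 2 (4 * (q - 1) + 1)); [apply sum3sq_1_mod4| |]; auto; lia.
- destruct (parity_cases q) as [[i ->]|[i ->]].
  + destruct (Z_lt_ge_dec i 5) as [Hlt|Hge].
    * assert (E : i = 1 \/ i = 4) by lia. destruct E as [-> | ->].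
      -- exists 0, 1, 2, 2; repeat split; auto; lia.
      -- exists 0, 7, 2, 2; repeat split; auto; lia.
    * apply (P 5 (8 * (i - 5) + 3)); [apply sum3sq_3_mod8| |]; auto; lia.
  + apply (P 1 (8 * i + 3)); [apply sum3sq_3_mod8| |]; auto; lia.
- apply (P 1 (4 * q + 1)); [apply sum3sq_1_mod4| |]; auto; lia.
- destruct (@div_mod_cases q 4 ltac:(lia)) as (i & s & Hi & Hs).
  assert (Hs' : s = 0 \/ s = 1 \/ s = 2 \/ s = 3) by lia.
  destruct Hs' as [-> |[-> |[-> | ->]]].
  + destruct (Z_lt_ge_dec i 5) as [Hlt|Hge].
    * assert (E : i = 1 \/ i = 4) by lia. destruct E as [-> | ->].
      -- exists 0, 4, 4, 1; repeat split; auto; lia.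
      -- exists 0, 8, 8, 1; repeat split; auto; lia.
    * apply (P4 7 (4 * (i - 5) + 2)); [apply sum3sq_2_mod4| |]; auto; lia.
  + apply (P4 1 (4 * i + 1)); [apply sum3sq_1_mod4| |]; auto; lia.
  + apply (P4 1 (4 * i + 2)); [apply sum3sq_2_mod4| |]; auto; lia.
  + destruct (Z_lt_ge_dec i 2) as [Hlt|Hge].
    * assert (E : i = 1) by lia. subst i.
      exists 1, 5, 2, 2; repeat split; auto; lia.
    * apply (P4 5 (4 * (i - 2) + 2)); [apply sum3sq_2_mod4| |]; auto; lia.
- apply (P 1 (4 * q + 2)); [apply sum3sq_2_mod4| |]; auto; lia.
Qed.

(** Choose w so that M - 3 w^2 is odd and no square; then y and z cannot both vanish. If M is even
    and M - 3 = v^2, then M = v^2 + 1 + 2; if M is an odd square, M - 12 = 5 modulo 8 is no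
    square. *)
Lemma form_1123 (M : Z) : 4 <= M -> (exists n, M = 3 * n + 1) ->
  exists x y z w, M = x * x + y * y + 2 * (z * z) + 3 * (w * w) /\
    coprime3 x /\ 0 < y * y + 2 * (z * z).
Proof.
intros HM [n Hn].
assert (P : forall k w, k = M - 3 * (w * w) -> 0 < k -> odd_Z k -> (forall v, k <> v * v) ->
  exists x y z w, M = x * x + y * y + 2 * (z * z) + 3 * (w * w) /\
    coprime3 x /\ 0 < y * y + 2 * (z * z)).
{ intros k w Hk Hk0 Ho Hs; destruct (form112_odd Hk0 Ho) as (x & y & z & E).
  assert (Q : forall x y z, k = x * x + y * y + 2 * (z * z) -> coprime3 x ->
    exists x y z w, M = x * x + y * y + 2 * (z * z) + 3 * (w * w) /\
    coprime3 x /\ 0 < y * y + 2 * (z * z)).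
  { clear x y z E; intros x y z E Hx; exists x, y, z, w; repeat split; [lia|exact Hx|].
    specialize (Hs x); nia. }
  destruct (mod3_cases x) as [[i ->]|[Hx _]]; [|apply (Q x y z); auto].
  destruct (mod3_cases y) as [[j ->]|[Hy _]]; [|apply (Q y (3 * i) z); auto; lia].
  destruct (mod3_cases z) as [[l ->]|[_ [l Hl]]]; exfalso; lia. }
destruct (parity_cases M) as [[i Hi]|[i Hi]].
- destruct (square_cases (M - 3)) as [[v Hv]|Hv].
  + exists v, 1, 1, 0; split; [lia|split; [|lia]].
    apply (@coprime3_of_sqr _ (n - 1)); lia.
  + apply (P (M - 3) 1); [lia|lia|exists (i - 2); lia|exact Hv].
- destruct (square_cases M) as [[v Hv]|Hv].
  + apply (P (M - 12) 2); [lia| |exists (i - 6); lia|].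
    * destruct (square_mod4 v) as [m [Hm|Hm]]; lia.
    * intros u Hu; destruct (square_mod4 v), (square_mod4 u); lia.
  + apply (P M 0); [lia|lia|exists i; lia|exact Hv].
Qed.

Lemma form_3_1_1_2 (N : Z) : 4 <= N -> (exists n, N = 3 * n + 1) ->
  exists h a b c, N = 3 * (h * h) + a * a + b * b + 2 * (c * c) /\
    coprime3 a /\ coprime3 b /\ coprime3 c.
Proof.
intros HN [n Hn]; destruct (@form_1123 N HN (ex_intro _ n Hn)) as (x & y & z & w & E & Hx & Hyz).
destruct (coprime3_sqr Hx) as [i Hi].
assert (H : exists k, y * y + 2 * (z * z) = 3 * k) by (exists (n - i - w * w); lia).
destruct H as [k Hk].
destruct (@norm3_coprime k ltac:(lia) y z Hk) as (b & c & Hb & Hc & F).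
exists w, x, b, c; repeat split; auto; lia.
Qed.

(** What is missing in [form_1123] is M = 0 modulo 3, where a pair of norm divisible by 3 is made
    prime to 3, and M = 2 modulo 3, where 18 h^2 = 2 (3 h)^2 reduces to [form_18_1_1_3]. *)
Lemma form_1123_coprime3 (M : Z) : 2 <= M ->
  exists x y z w, M = x * x + y * y + 2 * (z * z) + 3 * (w * w) /\
    coprime3 x /\ 0 < y * y + 2 * (z * z).
Proof.
intros HM; destruct (@div_mod_cases M 3 ltac:(lia)) as (n & r & Hn & Hr).
assert (Hr' : r = 0 \/ r = 1 \/ r = 2) by lia; destruct Hr' as [-> |[-> | ->]].
- assert (P : forall k w, k = M - 3 * (w * w) -> 0 < k -> odd_Z k ->
    exists x y z w, M = x * x + y * y + 2 * (z * z) + 3 * (w * w) /\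
      coprime3 x /\ 0 < y * y + 2 * (z * z)).
  { intros k w Hk Hk0 Ho; destruct (form112_odd Hk0 Ho) as (x & y & z & E).
    assert (Q : forall x y z, k = x * x + y * y + 2 * (z * z) -> 0 < x * x + 2 * (z * z) ->
      (exists m, x * x + 2 * (z * z) = 3 * m) ->
      exists x y z w, M = x * x + y * y + 2 * (z * z) + 3 * (w * w) /\
      coprime3 x /\ 0 < y * y + 2 * (z * z)).
    { clear x y z E; intros x y z E Hp [m Hm].
      destruct (@norm3_coprime m ltac:(lia) x z Hm) as (a & b & Ha & Hb & F).
      exists a, y, b, w; repeat split; [lia|exact Ha|].
      destruct Hb as [l Hl]; nia. }
    assert (H : 0 < x * x + 2 * (z * z) \/ 0 < y * y + 2 * (z * z)) by nia.
    pose proof (Z.square_nonneg x); pose proof (Z.square_nonneg y); pose proof (Z.square_nonneg z).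
    destruct (mod3_cases x) as [[i ->]|[_ [i Hi]]]; destruct (mod3_cases y) as [[j ->]|[_ [j Hj]]];
      destruct (mod3_cases z) as [[l ->]|[_ [l Hl]]]; try (exfalso; lia).
    - destruct H as [H|H].
      + apply (Q (3 * i) (3 * j) (3 * l)); auto; exists (3 * i * i + 6 * l * l); lia.
      + apply (Q (3 * j) (3 * i) (3 * l)); auto; [lia|]; exists (3 * j * j + 6 * l * l); lia.
    - apply (Q y (3 * i) z); [lia|lia|exists (j + 2 * l + 1); lia].
    - apply (Q x (3 * j) z); [lia|lia|exists (i + 2 * l + 1); lia]. }
  destruct (parity_cases M) as [[i Hi]|[i Hi]].
  + apply (P (M - 3) 1); [lia|lia|exists (i - 2); lia].
  + apply (P M 0); [lia|lia|exists i; lia].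
- apply form_1123; [lia|exists n; lia].
- destruct (Z.eq_dec M 2) as [->|].
  + exists 1, 1, 0, 0; split; [lia|split; [exists 0|]; lia].
  + destruct (@form_18_1_1_3 M ltac:(lia) (ex_intro _ n Hn)) as (h & a & b & c & E & Ha & Hb & _).
    exists a, b, (3 * h), c; split; [lia|split; [exact Ha|]].
    destruct Hb as [l Hl]; nia.
Qed.

(** Three times a representation of n + 2; the factor 3 before y^2 + 2 z^2 is absorbed by
    [norm3_coprime]. *)
Lemma form_9_1_2_3 (n : Z) : 0 <= n ->
  exists h a b c, 3 * n + 6 = 9 * (h * h) + a * a + 2 * (b * b) + 3 * (c * c) /\
    coprime3 a /\ coprime3 b /\ coprime3 c.
Proof.
intros Hn; destruct (@form_1123_coprime3 (n + 2) ltac:(lia)) as (x & y & z & w & E & Hx & Hp).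
destruct (norm3_coprime Hp) with (a := y + 2 * z) (b := y - z) as (a & b & Ha & Hb & F); [lia|].
exists w, a, b, x; repeat split; auto; lia.
Qed.

Lemma form_3_9_1_2 (n : Z) : 0 <= n ->
  exists h l a b, 3 * n + 3 = 3 * (h * h) + 9 * (l * l) + a * a + 2 * (b * b) /\
    coprime3 a /\ coprime3 b.
Proof.
intros Hn.
assert (H : exists x y z w, n + 1 = x * x + y * y + 2 * (z * z) + 3 * (w * w) /\
  0 < y * y + 2 * (z * z)).
{ destruct (Z.eq_dec n 0) as [->|].
  - exists 0, 1, 0, 0; lia.
  - destruct (@form_1123_coprime3 (n + 1) ltac:(lia)) as (x & y & z & w & E & _ & Hp).
    exists x, y, z, w; auto. }
destruct H as (x & y & z & w & E & Hp).
destruct (norm3_coprime Hp) with (a := y + 2 * z) (b := y - z) as (a & b & Ha & Hb & F); [lia|].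
exists x, w, a, b; repeat split; auto; lia.
Qed.

(** * Quaternary forms with odd variables *)

(** Six times 4 n + 1 = a^2 + 4 b^2 + 4 c^2 is 3 (a + 2 b)^2 + 3 (a - 2 b)^2 + 24 c^2, and 3 e^2 =
    e^2 + 2 e^2 is rewritten with variables prime to 3; they are odd because 3 e^2 = 3 modulo 8. *)
Lemma form_3_24_1_2 (n : Z) : 0 <= n ->
  exists u y v w, 24 * n + 6 = 3 * (u * u) + 24 * (y * y) + v * v + 2 * (w * w) /\
    odd_Z u /\ (odd_Z v /\ coprime3 v) /\ (odd_Z w /\ coprime3 w).
Proof.
intros Hn; destruct (three_squares_1_mod4 Hn) as (a & b & c & E & [k ->]).
set (e := 2 * k + 1 - 2 * b).
assert (Ho : odd_Z e) by (exists (k - b); unfold e; lia).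
destruct (odd_sqr Ho) as [i Hi].
destruct (@norm3_coprime (e * e) ltac:(nia) e e ltac:(lia)) as (v & w & Hv & Hw & F).
destruct (@odd_sqr_form v w (3 * i)) as [Hvo Hwo]; [lia|].
exists (2 * k + 1 + 2 * b), c, v, w; repeat split; auto; [|exists (k + b); lia].
rewrite <- Z.add_assoc, F; unfold e; lia.
Qed.

(** With v = 1, the rest 24 n + 5 = a^2 + 4 b^2 + 4 c^2 equals a^2 + 2 (b - c)^2 + 2 (b + c)^2.
    Since 24 n + 5 = 2 modulo 3 is no square there, one of b + c, b - c is prime to 3 and becomes w.
    What remains is 3 (u^2 + 2 y^2) with u^2 + 2 y^2 = 1 modulo 8, so y is even. *)
Lemma form_3_9_24_2 (n : Z) : 0 <= n ->
  exists u v y w, 24 * n + 14 = 3 * (u * u) + 9 * (v * v) + 24 * (y * y) + 2 * (w * w) /\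
    odd_Z u /\ odd_Z v /\ (odd_Z w /\ coprime3 w).
Proof.
intros Hn; destruct (@three_squares_1_mod4 (6 * n + 1) ltac:(lia)) as (a & b & c & E & Ha).
destruct (odd_sqr Ha) as [i Hi].
assert (H3 : coprime3 b \/ coprime3 c).
{ destruct (mod3_cases b) as [[j ->]|[]]; [|auto].
  destruct (mod3_cases c) as [[l ->]|[]]; [exfalso|auto].
  destruct (mod3_cases a) as [[m ->]|[_ [m Hm]]]; lia. }
assert (P : forall f w, 24 * n + 5 = a * a + 2 * (f * f) + 2 * (w * w) -> odd_Z f -> odd_Z w ->
  coprime3 w -> exists u v y w, 24 * n + 14 = 3 * (u * u) + 9 * (v * v) + 24 * (y * y) + 2 * (w * w) /\
    odd_Z u /\ odd_Z v /\ (odd_Z w /\ coprime3 w)).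
{ intros f w F Hf Hw Hw3; destruct (coprime3_sqr Hw3) as [m Hm].
  destruct (odd_sqr Hf) as [j Hj].
  destruct (@norm_div3 a f (8 * n - 2 * m + 1)) as (u & y & G); [lia|].
  assert (G3 : 3 * (u * u + 2 * (y * y)) = a * a + 2 * (f * f)) by lia.
  assert (G1 : exists l, u * u + 2 * (y * y) = 8 * l + 1).
  { exists (3 * (i + 2 * j) + 1 - (u * u + 2 * (y * y))); lia. }
  destruct G1 as [l Hl]; destruct (odd_even_sqr_form Hl) as [Hu [y' ->]].
  exists u, 1, y', w; repeat split; auto; [lia|exists 0; lia]. }
assert (Hbc : odd_Z (b + c)).
{ destruct (parity_cases b) as [[j ->]|[j ->]]; destruct (parity_cases c) as [[l ->]|[l ->]];
    try (exfalso; lia); [exists (j + l)|exists (j + l)]; lia. }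
assert (Hbc' : odd_Z (b - c)) by (destruct Hbc as [l Hl]; exists (l - c); lia).
destruct (coprime3_add_or_sub H3) as [H|H].
- apply (P (b - c) (b + c)); auto; lia.
- apply (P (b + c) (b - c)); auto; lia.
Qed.

(** The scheme of [form_3_9_24_2] with v = 1, starting from twice 12 n + 2 = f^2 + b^2 + 4 c^2. *)
Lemma form_3_18_24_1 (n : Z) : 0 <= n ->
  exists u v y w, 24 * n + 22 = 3 * (u * u) + 18 * (v * v) + 24 * (y * y) + w * w /\
    odd_Z u /\ odd_Z v /\ (odd_Z w /\ coprime3 w).
Proof.
intros Hn; destruct (@three_squares_2_mod4 (3 * n) ltac:(lia)) as (f & b & c & E & Hf & [k ->]).
destruct (odd_sqr Hf) as [j Hj].
assert (H3 : coprime3 (2 * k + 1) \/ coprime3 (2 * c)).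
{ destruct (mod3_cases (2 * k + 1)) as [[i Hi]|[]]; [|auto].
  destruct (mod3_cases (2 * c)) as [[l Hl]|[]]; [exfalso|auto].
  rewrite Hi in E; replace (4 * (c * c)) with ((2 * c) * (2 * c)) in E by ring; rewrite Hl in E.
  destruct (mod3_cases f) as [[m ->]|[_ [m Hm]]]; lia. }
assert (P : forall a w, 24 * n + 4 = a * a + w * w + 2 * (f * f) -> odd_Z a -> odd_Z w ->
  coprime3 w -> exists u v y w, 24 * n + 22 = 3 * (u * u) + 18 * (v * v) + 24 * (y * y) + w * w /\
    odd_Z u /\ odd_Z v /\ (odd_Z w /\ coprime3 w)).
{ intros a w F Ha Hw Hw3; destruct (coprime3_sqr Hw3) as [m Hm].
  destruct (odd_sqr Ha) as [i Hi].
  destruct (@norm_div3 a f (8 * n - m + 1)) as (u & y & G); [lia|].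
  assert (G1 : exists l, u * u + 2 * (y * y) = 8 * l + 1).
  { exists (3 * (i + 2 * j) + 1 - (u * u + 2 * (y * y))); lia. }
  destruct G1 as [l Hl]; destruct (odd_even_sqr_form Hl) as [Hu [y' ->]].
  exists u, 1, y', w; repeat split; auto; [lia|exists 0; lia]. }
assert (Ho : odd_Z (2 * k + 1 + 2 * c)) by (exists (k + c); lia).
assert (Ho' : odd_Z (2 * k + 1 - 2 * c)) by (exists (k - c); lia).
destruct (coprime3_add_or_sub H3) as [H|H].
- apply (P (2 * k + 1 - 2 * c) (2 * k + 1 + 2 * c)); auto; lia.
- apply (P (2 * k + 1 + 2 * c) (2 * k + 1 - 2 * c)); auto; lia.
Qed.

(** Same scheme from twice 12 n + 5; now u^2 + 2 v^2 = 3 modulo 8 makes both variables odd. *)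
Lemma form_3_6_1 (n : Z) : 0 <= n ->
  exists u v w, 24 * n + 10 = 3 * (u * u) + 6 * (v * v) + w * w /\
    odd_Z u /\ odd_Z v /\ (odd_Z w /\ coprime3 w).
Proof.
intros Hn; destruct (@three_squares_1_mod4 (3 * n + 1) ltac:(lia)) as (a0 & f & c & E & [k ->]).
assert (H3 : coprime3 (2 * k + 1) \/ coprime3 (2 * c)).
{ destruct (mod3_cases (2 * k + 1)) as [[i Hi]|[]]; [|auto].
  destruct (mod3_cases (2 * c)) as [[l Hl]|[]]; [exfalso|auto].
  rewrite Hi in E; replace (4 * (c * c)) with ((2 * c) * (2 * c)) in E by ring; rewrite Hl in E.
  destruct (mod3_cases f) as [[m ->]|[_ [m Hm]]]; lia. }
assert (P : forall a w, 24 * n + 10 = a * a + w * w + 8 * (f * f) -> odd_Z a -> odd_Z w ->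
  coprime3 w -> exists u v w, 24 * n + 10 = 3 * (u * u) + 6 * (v * v) + w * w /\
    odd_Z u /\ odd_Z v /\ (odd_Z w /\ coprime3 w)).
{ intros a w F Ha Hw Hw3; destruct (coprime3_sqr Hw3) as [m Hm].
  destruct (odd_sqr Ha) as [i Hi].
  destruct (@norm_div3 a (2 * f) (8 * n - m + 3)) as (u & v & G); [lia|].
  assert (G1 : exists l, u * u + 2 * (v * v) = 8 * l + 3).
  { exists (3 * (i + f * f) - (u * u + 2 * (v * v))); lia. }
  destruct G1 as [l Hl]; destruct (odd_sqr_form Hl) as [Hu Hv].
  exists u, v, w; repeat split; auto; lia. }
assert (Ho : odd_Z (2 * k + 1 + 2 * c)) by (exists (k + c); lia).
assert (Ho' : odd_Z (2 * k + 1 - 2 * c)) by (exists (k - c); lia).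
destruct (coprime3_add_or_sub H3) as [H|H].
- apply (P (2 * k + 1 - 2 * c) (2 * k + 1 + 2 * c)); auto; lia.
- apply (P (2 * k + 1 + 2 * c) (2 * k + 1 - 2 * c)); auto; lia.
Qed.

(** Six times a^2 + b^2 + 2 g^2 is 3 (a + b)^2 + 6 g^2 + 3 ((a - b)^2 + 2 g^2). The last term is 1
    modulo 8, so it becomes w^2 + 2 z^2 with z even. *)
Lemma form_3_6_1_8 (n : Z) : 0 <= n ->
  exists u v w z, 24 * n + 18 = 3 * (u * u) + 6 * (v * v) + w * w + 8 * (z * z) /\
    odd_Z u /\ odd_Z v /\ (odd_Z w /\ coprime3 w) /\ coprime3 z.
Proof.
intros Hn; destruct (@form112_odd (4 * n + 3) ltac:(lia)) as (a & b & g & E).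
{ exists (2 * n + 1); lia. }
assert (H : odd_Z (a + b) /\ odd_Z (a - b) /\ odd_Z g).
{ destruct (parity_cases g) as [[j ->]|Hg].
  - exfalso; destruct (square_mod4 a), (square_mod4 b); lia.
  - destruct (parity_cases a) as [[i ->]|[i ->]]; destruct (parity_cases b) as [[l ->]|[l ->]];
      try (exfalso; lia);
      (split; [exists (i + l); lia|split; [|exact Hg]]); [exists (i - l - 1)|exists (i - l)]; lia. }
destruct H as (Hu & Hc & Hg).
destruct (odd_sqr Hc) as [i Hi]; destruct (odd_sqr Hg) as [j Hj].
pose proof (Z.square_nonneg (a - b)); pose proof (Z.square_nonneg g).
destruct (@norm3_coprime ((a - b) * (a - b) + 2 * (g * g)) ltac:(lia)
  (a - b + 2 * g) (a - b - g) ltac:(lia)) as (w & z & Hw & Hz & F).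
destruct (@odd_even_sqr_form w z (3 * (i + 2 * j) + 1)) as [Hwo [z' ->]]; [lia|].
exists (a + b), g, w, z'; repeat split; auto; [lia|apply coprime3_of_mul2, Hz].
Qed.

Lemma form_3_6_9_8 (n : Z) : 0 <= n ->
  exists u v w z, 24 * n + 26 = 3 * (u * u) + 6 * (v * v) + 9 * (w * w) + 8 * (z * z) /\
    odd_Z u /\ odd_Z v /\ odd_Z w /\ coprime3 z.
Proof.
intros Hn; destruct (@three_squares_1_mod4 (6 * n + 4) ltac:(lia)) as (a & b & c & E & Ha).
destruct (odd_sqr Ha) as [i Hi].
assert (H3 : coprime3 b \/ coprime3 c).
{ destruct (mod3_cases b) as [[j ->]|[]]; [|auto].
  destruct (mod3_cases c) as [[l ->]|[]]; [exfalso|auto].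
  destruct (mod3_cases a) as [[m ->]|[_ [m Hm]]]; lia. }
assert (P : forall f z, 24 * n + 17 = a * a + 8 * (f * f) + 8 * (z * z) -> coprime3 (2 * z) ->
  exists u v w z, 24 * n + 26 = 3 * (u * u) + 6 * (v * v) + 9 * (w * w) + 8 * (z * z) /\
    odd_Z u /\ odd_Z v /\ odd_Z w /\ coprime3 z).
{ intros f z F Hz; apply coprime3_of_mul2 in Hz; destruct (coprime3_sqr Hz) as [m Hm].
  destruct (@norm_div3 a (2 * f) (8 * n - 8 * m + 3)) as (u & v & G); [lia|].
  assert (G1 : exists l, u * u + 2 * (v * v) = 8 * l + 3).
  { exists (3 * (i + f * f) - (u * u + 2 * (v * v))); lia. }
  destruct G1 as [l Hl]; destruct (odd_sqr_form Hl) as [Hu Hv].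
  exists u, v, 1, z; repeat split; auto; [lia|exists 0; lia]. }
assert (Hbc : exists f z, b + c = 2 * f /\ b - c = 2 * z).
{ destruct (parity_cases b) as [[j ->]|[j ->]]; destruct (parity_cases c) as [[l ->]|[l ->]];
    try (exfalso; lia); [exists (j + l), (j - l)|exists (j + l + 1), (j - l)]; lia. }
destruct Hbc as (f & z & Hf & Hz).
assert (Hb : b = f + z) by lia; assert (Hc : c = f - z) by lia.
assert (F : 24 * n + 17 = a * a + 8 * (f * f) + 8 * (z * z)) by (rewrite Hb Hc in E; lia).
destruct (coprime3_add_or_sub H3) as [H|H].
- apply (P z f); [lia|rewrite <- Hf; exact H].
- apply (P f z); [lia|rewrite <- Hz; exact H].
Qed.

(** * From quadratic forms to polygonal sums *)

Lemma p_eq (m x v : Z) : (m - 2) * x * x - (m - 4) * x = 2 * v -> p m x = v.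
Proof. intros H; unfold p; rewrite H Z.mul_comm Z.div_mul; [reflexivity|discriminate]. Qed.

Lemma p_ge0 (m x : Z) : 3 <= m -> 0 <= p m x.
Proof.
intros Hm; apply Z.div_pos; [|lia].
assert (H1 : 0 <= x * x - x) by nia.
assert (H2 : 0 <= x * x + x) by nia.
replace ((m - 2) * x * x - (m - 4) * x) with ((m - 3) * (x * x - x) + (x * x + x)) by ring.
nia.
Qed.

Lemma universal4_intro (a r b s c t d u : Z) :
  0 <= a -> 0 <= b -> 0 <= c -> 0 <= d -> 3 <= r -> 3 <= s -> 3 <= t -> 3 <= u ->
  (forall N, 0 <= N -> exists h l m n, a * p r h + b * p s l + c * p t m + d * p u n = N) ->
  universal4 a r b s c t d u.
Proof.
intros Ha Hb Hc Hd Hr Hs Ht Hu H N; split; [apply H|].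
intros (h & l & m & n & <-).
pose proof (@p_ge0 r h Hr); pose proof (@p_ge0 s l Hs);
  pose proof (@p_ge0 t m Ht); pose proof (@p_ge0 u n Hu).
nia.
Qed.

Lemma p4E (x : Z) : p 4 x = x * x.
Proof. apply p_eq; ring. Qed.

(** 3 p_8(x) + 1 = (3 x - 1)^2, and x is chosen to match [a] up to sign. *)
Lemma p8_of_coprime3 (a : Z) : coprime3 a -> exists x, a * a = 3 * p 8 x + 1.
Proof.
intros [k [-> | ->]]; [exists (- k)|exists k].
- rewrite (@p_eq 8 (- k) (3 * k * k + 2 * k)); ring.
- rewrite (@p_eq 8 k (3 * k * k - 2 * k)); ring.
Qed.

(** 24 p_5(x) + 1 = (6 x - 1)^2, again up to the sign of [a]. *)
Lemma p5_of_coprime6 (a : Z) : odd_Z a /\ coprime3 a -> exists x, a * a = 24 * p 5 x + 1.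
Proof.
intros [[i Hi] [k Hk]].
destruct (parity_cases k) as [[j Hj]|[j Hj]]; [|exfalso; lia].
assert (3 * j * j + j = 2 * ((3 * j * j + j) / 2) /\ 3 * j * j - j = 2 * ((3 * j * j - j) / 2)) as [H1 H2].
{ destruct (parity_cases j) as [[l ->]|[l ->]]; split; apply Z_div_exact_full_2; try discriminate.
  - replace (3 * (2 * l) * (2 * l) + 2 * l) with ((6 * l * l + l) * 2) by ring; apply Z_mod_mult.
  - replace (3 * (2 * l) * (2 * l) - 2 * l) with ((6 * l * l - l) * 2) by ring; apply Z_mod_mult.
  - replace (3 * (2 * l + 1) * (2 * l + 1) + (2 * l + 1)) with ((6 * l * l + 7 * l + 2) * 2) by ring.
    apply Z_mod_mult.
  - replace (3 * (2 * l + 1) * (2 * l + 1) - (2 * l + 1)) with ((6 * l * l + 5 * l + 1) * 2) by ring.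
    apply Z_mod_mult. }
destruct Hk as [Hk|Hk].
- exists (- j); rewrite (@p_eq 5 (- j) ((3 * j * j + j) / 2)); [|lia].
  replace a with (6 * j + 1) by lia; lia.
- exists j; rewrite (@p_eq 5 j ((3 * j * j - j) / 2)); [|lia].
  replace a with (6 * j - 1) by lia; lia.
Qed.

Lemma p3_of_odd (a : Z) : odd_Z a -> exists x, a * a = 8 * p 3 x + 1.
Proof.
intros [k ->]; exists k.
assert (H : exists j, k * k + k = 2 * j).
{ destruct (parity_cases k) as [[j ->]|[j ->]];
    [exists (2 * j * j + j)|exists (2 * j * j + 3 * j + 1)]; ring. }
destruct H as [j Hj]; rewrite (@p_eq 3 k j); lia.
Qed.

Theorem theorem3p2 :
  universal4 6 4 1 8 1 8 2 8 /\
  universal4 3 4 1 8 2 8 2 8 /\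
  universal4 6 4 1 8 1 8 3 8 /\
  universal4 3 4 1 8 2 8 3 8 /\
  universal4 1 4 6 4 1 8 1 8 /\
  universal4 1 4 3 4 1 8 2 8 /\
  universal4 1 4 1 8 1 8 2 8 /\
  universal4 1 3 1 4 1 5 2 5 /\
  universal4 1 3 3 3 1 4 2 5 /\
  universal4 1 3 6 3 1 4 1 5 /\
  universal4 1 3 2 3 3 4 1 5 /\
  universal4 1 3 2 3 1 5 1 8 /\
  universal4 1 3 2 3 3 3 1 8.
Proof.
refine (conj _ (conj _ (conj _ (conj _ (conj _ (conj _ (conj _ (conj _ (conj _ (conj _
  (conj _ (conj _ _)))))))))))); apply universal4_intro; try lia; intros N HN.
- destruct (@form_18_1_1_2 (3 * N + 4)) as (h & a & b & c & E & Ha & Hb & Hc);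
    [lia|exists (N + 1); lia|].
  destruct (p8_of_coprime3 Ha) as [x Hx], (p8_of_coprime3 Hb) as [y Hy], (p8_of_coprime3 Hc) as [z Hz].
  exists h, x, y, z; rewrite p4E; lia.
- destruct (@form_9_1_2_2 (3 * N + 5)) as (h & a & b & c & E & Ha & Hb & Hc);
    [lia|exists (N + 1); lia|].
  destruct (p8_of_coprime3 Ha) as [x Hx], (p8_of_coprime3 Hb) as [y Hy], (p8_of_coprime3 Hc) as [z Hz].
  exists h, x, y, z; rewrite p4E; lia.
- destruct (@form_18_1_1_3 (3 * N + 5)) as (h & a & b & c & E & Ha & Hb & Hc);
    [lia|exists (N + 1); lia|].
  destruct (p8_of_coprime3 Ha) as [x Hx], (p8_of_coprime3 Hb) as [y Hy], (p8_of_coprime3 Hc) as [z Hz].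
  exists h, x, y, z; rewrite p4E; lia.
- destruct (form_9_1_2_3 HN) as (h & a & b & c & E & Ha & Hb & Hc).
  destruct (p8_of_coprime3 Ha) as [x Hx], (p8_of_coprime3 Hb) as [y Hy], (p8_of_coprime3 Hc) as [z Hz].
  exists h, x, y, z; rewrite p4E; lia.
(* The term 3 c^2 of [form_18_1_1_3] serves as 3 p_4; at N = 0 the number 3 N + 2 is below 5. *)
- destruct (Z.eq_dec N 0) as [->|]; [exists 0, 0, 0, 0; reflexivity|].
  destruct (@form_18_1_1_3 (3 * N + 2)) as (h & a & b & c & E & Ha & Hb & _);
    [lia|exists N; lia|].
  destruct (p8_of_coprime3 Ha) as [x Hx], (p8_of_coprime3 Hb) as [y Hy].
  exists c, h, x, y; rewrite !p4E; lia.
- destruct (form_3_9_1_2 HN) as (h & l & a & b & E & Ha & Hb).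
  destruct (p8_of_coprime3 Ha) as [x Hx], (p8_of_coprime3 Hb) as [y Hy].
  exists h, l, x, y; rewrite !p4E; lia.
- destruct (@form_3_1_1_2 (3 * N + 4)) as (h & a & b & c & E & Ha & Hb & Hc);
    [lia|exists (N + 1); lia|].
  destruct (p8_of_coprime3 Ha) as [x Hx], (p8_of_coprime3 Hb) as [y Hy], (p8_of_coprime3 Hc) as [z Hz].
  exists h, x, y, z; rewrite p4E; lia.
- destruct (form_3_24_1_2 HN) as (u & y & v & w & E & Hu & Hv & Hw).
  destruct (p3_of_odd Hu) as [x Hx], (p5_of_coprime6 Hv) as [i Hi], (p5_of_coprime6 Hw) as [j Hj].
  exists x, y, i, j; rewrite p4E; lia.
- destruct (form_3_9_24_2 HN) as (u & v & y & w & E & Hu & Hv & Hw).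
  destruct (p3_of_odd Hu) as [x Hx], (p3_of_odd Hv) as [i Hi], (p5_of_coprime6 Hw) as [j Hj].
  exists x, i, y, j; rewrite p4E; lia.
- destruct (form_3_18_24_1 HN) as (u & v & y & w & E & Hu & Hv & Hw).
  destruct (p3_of_odd Hu) as [x Hx], (p3_of_odd Hv) as [i Hi], (p5_of_coprime6 Hw) as [j Hj].
  exists x, i, y, j; rewrite p4E; lia.
- destruct (form_3_6_1 HN) as (u & v & w & E & Hu & Hv & Hw).
  destruct (p3_of_odd Hu) as [x Hx], (p3_of_odd Hv) as [i Hi], (p5_of_coprime6 Hw) as [j Hj].
  (* Three variables already represent 24 N + 10, so the square is 0. *)
  exists x, i, 0, j; rewrite p4E; lia.
- destruct (form_3_6_1_8 HN) as (u & v & w & z & E & Hu & Hv & Hw & Hz).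
  destruct (p3_of_odd Hu) as [x Hx], (p3_of_odd Hv) as [i Hi], (p5_of_coprime6 Hw) as [j Hj],
    (p8_of_coprime3 Hz) as [k Hk].
  exists x, i, j, k; lia.
- destruct (form_3_6_9_8 HN) as (u & v & w & z & E & Hu & Hv & Hw & Hz).
  destruct (p3_of_odd Hu) as [x Hx], (p3_of_odd Hv) as [i Hi], (p3_of_odd Hw) as [j Hj],
    (p8_of_coprime3 Hz) as [k Hk].
  exists x, i, j, k; lia.
Qed.
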